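(* Let $G$ be a finite group with Haar measure $\mu$ that acts on $\mathcal X$ and let $\pi$ be a $G$-invariant probability measure. Let $\nu$ be a probability measure on $G\times G$ such that $(g,h)\overset{D}{=}(g^{-1},h^{-1})$ for $(g,h)\sim\nu$. Assume that the Markov kernels $P,M$ (and hence $P_{da}=P_{da}(G,\nu)$) are Hilbert–Schmidt operators on $L^2(\pi)$ and that $M,P_{da}\in\mathcal D(G,\nu)$. Then $$\|P-M\|_{\mathrm{HS}}^2=\|P-P_{da}\|_{\mathrm{HS}}^2+\|P_{da}-M\|_{\mathrm{HS}}^2.$$ If $\mathcal X$ is finite, then also $$\|P-M\|_{\mathrm F}^2=\|P-P_{da}\|_{\mathrm F}^2+\|P_{da}-M\|_{\mathrm F}^2.$$
   Context: $\mathcal X$ is a Polish space with its $\sigma$-algebra $\mathcal F$; $G$ acts measurably on it. $\pi$ is $G$-invariant if $\pi(gA)=\pi(A)$ for all $g\in G,A\in\mathcal F$. Standing assumption: $\pi$ has a density with respect to a reference measure $\mathfrak m$ on $\mathcal X$, and $\mathfrak m$ is invariant under every $g\in G$. $U_g[f](x)=f(gx)$; a Markov kernel $P$ acts by $P[f](x)=\int f(y)P(x,dy)$; $P_{da}(G,\nu)=\mathbb E_{(g,h)\sim\nu}(U_gPU_h)$. $\mathcal D(G,\nu)$ is the set of Markov kernels $K$ with $K_{da}(G,\nu)=K$. $\overset{D}{=}$ is equality in distribution. $\|T\|_{\mathrm{HS}}^2=\mathrm{Tr}(T^*T)=\sum_{e\in\mathcal B}\|T[e]\|_\pi^2$ for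 an orthonormal basis $\mathcal B$ of $L^2(\pi)$, with $T^*$ the $L^2(\pi)$-adjoint; for finite $\mathcal X$, $\|T\|_{\mathrm F}^2=\mathrm{Tr}(T^TT)=\sum_{x,y\in\mathcal X}T(x,y)^2$. *)

(* Defs.v *)
From HB Require Import structures.
From mathcomp Require Import all_boot all_order all_algebra all_fingroup.
From mathcomp Require Import all_classical all_reals all_analysis.
From mathcomp Require Import measurable_realfun.

Set Implicit Arguments.
Unset Strict Implicit.
Unset Printing Implicit Defensive.

Import Order.TTheory GRing.Theory Num.Theory.
Import numFieldNormedType.Exports.

Local Open Scope classical_set_scope.
Local Open Scope ring_scope.

(* [d] is a complete metric inducing the topology of [T]; its nonnegativity
   follows from the other clauses. *)
Definition complete_metric (R : realType) (T : topologicalType)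
    (d : T -> T -> R) : Prop :=
  [/\ forall x y, (d x y = 0) <-> (x = y),
      forall x y, d x y = d y x,
      forall x y z, d x z <= d x y + d y z,
      forall x (A : set T),
        nbhs x A <-> exists2 e : R, 0 < e & [set y | d x y < e] `<=` A
    & forall u : nat -> T,
        (forall e : R, 0 < e -> exists N, forall m n,
           (N <= m)%N -> (N <= n)%N -> d (u m) (u n) < e) ->
        exists l : T, u @ \oo --> l].

Definition polish (R : realType) (T : topologicalType) : Prop :=
  (exists2 D : set T, countable D & dense D) /\
  (exists d : T -> T -> R, complete_metric d).

Notation borel X := (g_sigma_algebraType (@open X)).

(* A finite group with the sigma-algebra of all its subsets. *)
Definition fdiscrete (gT : finGroupType) : Type := gT.

Section fdiscrete.
Context (gT : finGroupType).
HB.instance Definition _ := FinGroup.on (fdiscrete gT).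
HB.instance Definition _ := isPointed.Build (fdiscrete gT) 1%g.
HB.instance Definition _ := @isMeasurable.Build default_measure_display
  (fdiscrete gT) discrete_measurable discrete_measurable0
  discrete_measurableC discrete_measurableU.
End fdiscrete.

(* Left actions; the actions of mathcomp's action.v are right actions. *)
Record measurable_action (gT : finGroupType) d (T : measurableType d) :=
  MeasurableAction {
    act :> gT -> T -> T;
    act1 : forall x, act 1%g x = x;
    actM : forall g h x, act (g * h)%g x = act g (act h x);
    measurable_actU :
      measurable_fun [set: fdiscrete gT * T] (fun p => act p.1 p.2)
  }.

Section definitions.
Context {R : realType} {gT : finGroupType} {d} {T : measurableType d}.
Implicit Types (a : measurable_action gT T) (m : {measure set T -> \bar R}).
Implicit Types (pi : probability T R).

Definition haar (mu : probability (fdiscrete gT) R) : Prop :=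
  forall (g : gT) (A : set (fdiscrete gT)),
    mu [set (g * h)%g | h in A] = mu A.

Definition invariant_measure a m : Prop :=
  forall g A, measurable A -> m (a g @` A) = m A.

Definition has_density pi m : Prop :=
  exists f : T -> R,
    [/\ measurable_fun setT f, forall x, 0 <= f x &
        forall A, measurable A -> pi A = (\int[m]_(x in A) (f x)%:E)%E].

Definition pair_inv (p : fdiscrete gT * fdiscrete gT) :
    fdiscrete gT * fdiscrete gT := (p.1^-1%g, p.2^-1%g).

Definition inv_symmetric
    (nu : probability (fdiscrete gT * fdiscrete gT)%type R) : Prop :=
  forall A, measurable A -> pushforward nu pair_inv A = nu A.

End definitions.

Lemma measurable_act (gT : finGroupType) d (T : measurableType d)
  (a : measurable_action gT T) (g : gT) : measurable_fun setT (a g).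
Proof.
have := @measurable_actU _ _ _ a.
move=> /(measurableT_comp)/(_ (pair1_measurable (g : fdiscrete gT))); exact.
Qed.

Lemma measurable_fdiscreteX (gT : finGroupType)
  (A : set (fdiscrete gT * fdiscrete gT)) : measurable A.
Proof.
have -> : A = \bigcup_(p in A) ([set p.1] `*` [set p.2]).
  apply/seteqP; split=> [[x y] Axy|[x y] [[x' y'] Ap [/= -> ->]]//].
  by exists (x, y).
apply: fin_bigcup_measurable; first exact: finite_finset.
by move=> p _; exact: measurableX.
Qed.

Section double_augmentation.
Context {R : realType} {gT : finGroupType} {d} {T : measurableType d}.
Variables (a : measurable_action gT T).
Variable nu : probability (fdiscrete gT * fdiscrete gT)%type R.
Variable P : R.-pker T ~> T.
Local Open Scope ereal_scope.

(* The kernel of U_g P U_h sends (x, A) to P (g x) {y | h y \in A}, because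
   U_g[P[U_h[f]]](x) = \int f(h y) P(g x, dy). *)
Definition da_set (x : T) (A : set T) : \bar R :=
  \int[nu]_gh pushforward (P (a gh.1 x)) (a gh.2) A.

Let da_set0 x : da_set x set0 = 0.
Proof.
rewrite /da_set integral0_eq// => gh _.
by rewrite /pushforward preimage_set0 measure0.
Qed.

Let da_set_ge0 x A : 0 <= da_set x A.
Proof. by apply: integral_ge0 => gh _; rewrite /pushforward measure_ge0. Qed.

Let da_set_sigma_additive x : semi_sigma_additive (da_set x).
Proof.
move=> F mF tF mUF.
have -> : da_set x (\bigcup_n F n) = \sum_(n <oo) da_set x (F n).
  rewrite /da_set -integral_nneseries//.
  - apply: eq_integral => gh _.
    rewrite /pushforward preimage_bigcup (measure_bigcup (P (a gh.1 x)))//; last 2 first.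
    + by move=> i _; rewrite -[X in measurable X]setTI; exact: measurable_act.
    + move/trivIsetP : tF => tF; apply/trivIsetP => i j _ _ ij.
      by rewrite -preimage_setI (tF _ _ _ _ ij)// preimage_set0.
    by apply: eq_eseriesl => i; rewrite in_setT.
  - by move=> n _ A _; exact: measurable_fdiscreteX.
  - by move=> n gh _; rewrite /pushforward measure_ge0.
by apply: is_cvg_nneseries => n _ _; exact: da_set_ge0.
Qed.

HB.instance Definition _ x := isMeasure.Build _ _ _ (da_set x)
  (da_set0 x) (da_set_ge0 x) (da_set_sigma_additive (x := x)).

Definition da : T -> {measure set T -> \bar R} := fun x => da_set x.

Let measurable_da U : measurable U -> measurable_fun setT (da ^~ U).
Proof.
move=> mU.
pose F (p : T * (fdiscrete gT * fdiscrete gT)) : \bar R :=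
  pushforward (P (a p.2.1 p.1)) (a p.2.2) U.
have -> : da ^~ U = (fun x => \int[nu]_gh F (x, gh)) by [].
apply: measurable_fun_fubini_tonelli_F.
  move=> _ B mB; rewrite setTI.
  have -> : F @^-1` B = \bigcup_(gh in [set: fdiscrete gT * fdiscrete gT])
      (((fun x => P (a gh.1 x) (a gh.2 @^-1` U)) @^-1` B) `*` [set gh]).
    apply/seteqP; split=> [[x gh] /= h|[x gh] [gh' _ [/= h ->]]//].
    by exists gh.
  apply: fin_bigcup_measurable; first exact: finite_finset.
  move=> gh _; apply: measurableX; last exact: measurable_fdiscreteX.
  rewrite -[X in measurable X]setTI.
  suff : measurable_fun setT (fun x => P (a gh.1 x) (a gh.2 @^-1` U)).
    by apply.
  apply: (@measurableT_comp _ _ _ _ _ _ (fun x => P x (a gh.2 @^-1` U))).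
    apply: measurable_kernel.
    by rewrite -[X in measurable X]setTI; exact: measurable_act.
  exact: measurable_act.
by move=> p; rewrite /F /pushforward measure_ge0.
Qed.

HB.instance Definition _ := isKernel.Build _ _ _ _ _ da measurable_da.

Let da_prob x : da x setT = 1.
Proof.
rewrite /da/= /da_set.
under eq_integral do rewrite /pushforward preimage_setT prob_kernel.
rewrite integral_cst// mul1e; exact: probability_setT.
Qed.

HB.instance Definition _ := Kernel_isProbability.Build _ _ _ _ _ da da_prob.

End double_augmentation.

Section da_class.
Context {R : realType} {gT : finGroupType} {d} {T : measurableType d}.
Variables (a : measurable_action gT T).
Variable nu : probability (fdiscrete gT * fdiscrete gT)%type R.

(* Kernels are compared on measurable sets only: the library's measures also
   take irrelevant values on non-measurable sets. *)
Definition da_class : set (R.-pker T ~> T) :=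
  [set K | forall x A, measurable A -> da a nu K x A = K x A].

End da_class.

Section hilbert_schmidt.
Context {R : realType} {d} {T : measurableType d}.
Variable pi : probability T R.
Implicit Types (K : R.-pker T ~> T) (B : set (T -> R)).
Implicit Types (A : (T -> R) -> (T -> R)).

Definition kernel_op K (f : T -> R) : T -> R := fun x => \int[K x]_y f y.

Definition L2norm (f : T -> R) : \bar R := 'N[pi]_2%:E[EFin \o f].

(* Elements of L^2(pi) are given by representatives; the elements of an
   orthonormal family lie in distinct classes. *)
Record orthonormal_basis B : Prop := OrthonormalBasis {
  onb_L2 : forall e, B e -> e \in Lfun pi 2%:E;
  onb_unit : forall e, B e -> \int[pi]_x (e x * e x) = 1;
  onb_orth : forall e e', B e -> B e' -> e <> e' ->
    \int[pi]_x (e x * e' x) = 0;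
  onb_dense : forall f, f \in Lfun pi 2%:E -> forall eps : R, 0 < eps ->
    exists n (e : 'I_n -> T -> R) (c : 'I_n -> R),
      (forall i, B (e i)) /\
      (L2norm (fun x => (f x - \sum_(i < n) c i * e i x)%R) < eps%:E)%E
}.

(* [kernel_op K f] is defined pi-almost everywhere for every f in L^2(pi), and
   f |-> kernel_op K f is bounded, hence compatible with pi-a.e. equality. *)
Definition bounded_on_L2 K : Prop :=
  (forall f, f \in Lfun pi 2%:E ->
     {ae pi, forall x, (K x).-integrable setT (EFin \o f)}) /\
  (exists C : R, forall f, f \in Lfun pi 2%:E ->
     (L2norm (kernel_op K f) <= C%:E * L2norm f)%E).

(* The value does not depend on the orthonormal basis B when A is bounded. *)
Definition hs_sqnorm B A : \bar R := (\esum_(e in B) (L2norm (A e) ^+ 2))%E.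

Definition hilbert_schmidt K : Prop :=
  bounded_on_L2 K /\
  exists2 B, orthonormal_basis B & (hs_sqnorm B (kernel_op K) < +oo)%E.

End hilbert_schmidt.

Section frobenius.
Context {R : realType} {d} {T : measurableType d}.

Definition kernel_mx (K : R.-pker T ~> T) (x y : T) : R := fine (K x [set y]).

(* Meaningful for finite T only: \sum_(x \in A) is 0 on infinite supports. *)
Definition frobenius_sqnorm (A : T -> T -> R) : R :=
  \sum_(x \in [set: T]) \sum_(y \in [set: T]) A x y ^+ 2.

End frobenius.

(* Main.v *)
From HB Require Import structures.
Require Import Defs.
From mathcomp Require Import all_boot all_order all_algebra all_fingroup.
From mathcomp Require Import finmap.
From mathcomp Require Import all_classical all_reals all_analysis.
From mathcomp Require Import measurable_realfun.
From mathcomp Require Import ring lra.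

(** Write U_g f = f(g .) and E(A) for the average of U_g A U_h over the pairs (g, h)
    drawn from nu.  The Markov kernel [da a nu P] represents E(P).  Since pi is
    invariant, every U_g is unitary on L^2(pi) with adjoint U_(g^-1); the
    Hilbert-Schmidt inner product is invariant under unitary changes of basis, so
    <U_g A U_h, B> = <A, U_(g^-1) B U_(h^-1)>.  As nu is invariant under inversion
    of both coordinates, E is self-adjoint for this inner product.  If E(P) and M
    are fixed by E then so is E(P) - M, hence
      <P - E(P), E(P) - M> = <P, E(P) - M> - <P, E(E(P) - M)> = 0,
    and the identity is Pythagoras' theorem.  The finite case is the same argument
    for the Frobenius inner product, where <U_g A U_h, B> = <A, U_(g^-1) B U_(h^-1)>
    is a mere reindexing of a double sum ([frobenius_ip_act]).

    The Hilbert-Schmidt part is proved for operators on a real vector space with a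
    semi-inner product.  A basis may be uncountable, so norms are sums of
    nonnegative terms over arbitrary sets, and the inner product is the absolutely
    convergent real sum [rsum].  The key point is that the norm does not depend on
    the basis ([hs_indep]).  For a bounded functional phi, the sum of the phi(e)^2
    over an orthonormal basis is the least S with phi(u)^2 <= S |u|^2 for all u
    ([onb_functional_le], [functional_le_onb]); it is therefore basis-independent,
    and for phi = <u, .> it gives Parseval's identity.  Expanding the norm of each
    A(e) by Parseval and exchanging the two sums reduces the norm of A to such
    functionals, without any adjoint or completeness.  Invariance under unitaries
    follows ([hs_conj]), then the adjunction above by polarization ([hsip_conj]),
    self-adjointness of E ([hsip_twirl]) and the identity
    ([hs_twirl_pythagoras]).

    It remains to see Markov kernels as operators on representatives of L^2(pi):
    they are defined and linear up to null sets only, and [da_kernel_op] evaluates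
    the kernel [da a nu P] as a weighted sum at the points where all the summands
    are integrable, which form a set of full measure by invariance of pi. *)

Set Implicit Arguments.
Unset Strict Implicit.
Unset Printing Implicit Defensive.

Import Order.TTheory GRing.Theory Num.Theory.
Import numFieldNormedType.Exports.
Local Open Scope classical_set_scope.
Local Open Scope ring_scope.

(** * Absolutely convergent sums over arbitrary index sets *)

Section real_sums.
Context {R : realType} {I : choiceType}.
Implicit Types (D : set I) (f g h : I -> R) (c : R).

Lemma ge0_esumZl D f (c : R) : 0 <= c -> (forall i, D i -> 0 <= f i) ->
  \esum_(i in D) (c * f i)%:E = (c%:E * \esum_(i in D) (f i)%:E)%E.
Proof.
move=> c0 f0; rewrite /esum -ereal_supZl//; last first.
  by apply/set0P; exists 0%E, set0; [exact: fsets_set0|rewrite fsbig_set0].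
congr ereal_sup; apply/seteqP; split=> [_ [X [fX XD] <-]|_ [_ [X [fX XD] <-] <-]].
  exists (\sum_(i \in X) (f i)%:E)%E; first by exists X.
  by rewrite !fsumEFin// -EFinM mulr_fsumr.
by exists X => //; rewrite !fsumEFin// -EFinM mulr_fsumr.
Qed.

Definition abs_summable D f := (\esum_(i in D) `|f i|%:E < +oo)%E.

Lemma abs_summable_le D f g : (forall i, D i -> `|f i| <= g i) ->
  (\esum_(i in D) (g i)%:E < +oo)%E -> abs_summable D f.
Proof.
by move=> fg; apply: le_lt_trans; apply: le_esum => i Di; rewrite lee_fin fg.
Qed.

(** Meaningful when [abs_summable D f] holds: the positive and negative parts then
    have finite sums. *)
Definition rsum D f : R :=
  fine ((\esum_(i in D) (EFin \o f)^\+ i) - (\esum_(i in D) (EFin \o f)^\- i))%E.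

Lemma eq_rsum D f g : (forall i, D i -> f i = g i) -> rsum D f = rsum D g.
Proof.
by move=> fg; congr (fine (_ - _)%E); apply: eq_esum => i Di;
  rewrite ?funeposE ?funenegE /= fg.
Qed.

Lemma ge0_esum_fin_num D g : (forall i, D i -> 0 <= g i) ->
  (\esum_(i in D) (g i)%:E < +oo)%E -> (\esum_(i in D) (g i)%:E)%E \is a fin_num.
Proof. by move=> g0 gy; rewrite ge0_fin_numE// esum_ge0. Qed.

(** Any splitting into summable nonnegative functions computes the sum, not only
    the positive and negative parts: this is what makes [rsum] linear. *)
Lemma rsumB_ge0 D g h : (forall i, D i -> 0 <= g i) -> (forall i, D i -> 0 <= h i) ->
  (\esum_(i in D) (g i)%:E < +oo)%E -> (\esum_(i in D) (h i)%:E < +oo)%E ->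
  rsum D (fun i => g i - h i) =
    fine (\esum_(i in D) (g i)%:E) - fine (\esum_(i in D) (h i)%:E).
Proof.
move=> g0 h0 gy hy; rewrite -fineB ?ge0_esum_fin_num//.
have sm (k : I -> R) : (forall i, D i -> 0 <= k i) -> (\esum_(i in D) (k i)%:E < +oo)%E ->
    summable D (EFin \o k).
  move=> k0; apply: le_lt_trans; apply: le_esum => i Di /=.
  by rewrite lee_fin ger0_norm// k0.
by rewrite -(esumB (sm g g0 gy) (sm h h0 hy)).
Qed.

Lemma ge0_rsum D f : (forall i, D i -> 0 <= f i) ->
  (\esum_(i in D) (f i)%:E < +oo)%E -> (rsum D f)%:E = \esum_(i in D) (f i)%:E.
Proof.
move=> f0 fy; rewrite (@eq_rsum D f (fun i => f i - 0)); last first.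
  by move=> i _; rewrite subr0.
have e0 : \esum_(i in D) (0 : R)%:E = 0%E by exact: esum1.
by rewrite rsumB_ge0 ?e0//= subr0 fineK// ge0_esum_fin_num.
Qed.

Lemma rsum_linear D c f g : abs_summable D f -> abs_summable D g ->
  rsum D (fun i => c * f i + g i) = c * rsum D f + rsum D g.
Proof.
(* The positive and negative parts of a function. *)
pose p (f : I -> R) i := (`|f i| + f i) / 2.
pose n (f : I -> R) i := (`|f i| - f i) / 2.
have p0 f' i : 0 <= p f' i by rewrite /p; have := lerNnormlW (lexx `|f' i|); lra.
have n0 f' i : 0 <= n f' i by rewrite /n; have := ler_norm (f' i); lra.
have py f' : abs_summable D f' -> (\esum_(i in D) (p f' i)%:E < +oo)%E.
  apply: le_lt_trans; apply: le_esum => i _; rewrite lee_fin /p.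
  by have := ler_norm (f' i); lra.
have ny f' : abs_summable D f' -> (\esum_(i in D) (n f' i)%:E < +oo)%E.
  apply: le_lt_trans; apply: le_esum => i _; rewrite lee_fin /n.
  by have := lerNnormlW (lexx `|f' i|); lra.
move=> fy gy.
have rE f' : abs_summable D f' -> rsum D f' =
    fine (\esum_(i in D) (p f' i)%:E) - fine (\esum_(i in D) (n f' i)%:E).
  move=> f'y; rewrite -(rsumB_ge0 _ _ (py f' f'y) (ny f' f'y))//.
  by apply: eq_rsum => i _; rewrite /p /n; lra.
have lin (k : R) (u v : I -> R) : 0 <= k -> (forall i, 0 <= u i) -> (forall i, 0 <= v i) ->
   \esum_(i in D) (k * u i + v i)%:E =
   (k%:E * (\esum_(i in D) (u i)%:E) + \esum_(i in D) (v i)%:E)%E.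
  move=> k0 u0 v0; under eq_esum do rewrite EFinD.
  by rewrite esumD ?ge0_esumZl// => i _; rewrite lee_fin ?mulr_ge0.
have liny (k : R) (u v : I -> R) : 0 <= k -> (forall i, 0 <= u i) -> (forall i, 0 <= v i) ->
   (\esum_(i in D) (u i)%:E < +oo)%E -> (\esum_(i in D) (v i)%:E < +oo)%E ->
   (\esum_(i in D) (k * u i + v i)%:E < +oo)%E.
  by move=> k0 u0 v0 uy vy; rewrite lin// lte_add_pinfty// lte_mul_pinfty.
have finlin (k : R) (u v : I -> R) : 0 <= k -> (forall i, 0 <= u i) -> (forall i, 0 <= v i) ->
   (\esum_(i in D) (u i)%:E < +oo)%E -> (\esum_(i in D) (v i)%:E < +oo)%E ->
   fine (\esum_(i in D) (k * u i + v i)%:E) =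
   k * fine (\esum_(i in D) (u i)%:E) + fine (\esum_(i in D) (v i)%:E).
  move=> k0 u0 v0 uy vy; rewrite lin// fineD ?fineM//.
  - by rewrite ge0_esum_fin_num.
  - by rewrite fin_numM// ge0_esum_fin_num.
  - by rewrite ge0_esum_fin_num.
have ge0lin (k : R) (u v : I -> R) : 0 <= k -> (forall i, 0 <= u i) -> (forall i, 0 <= v i) ->
  forall i, D i -> 0 <= k * u i + v i by move=> *; rewrite addr_ge0 ?mulr_ge0.
rewrite (rE f)// (rE g)//; have [c0|c0] := leP 0 c.
  transitivity (rsum D (fun i => (c * p f i + p g i) - (c * n f i + n g i))).
    by apply: eq_rsum => i _; rewrite /p /n; field.
  rewrite rsumB_ge0; [|exact: ge0lin|exact: ge0lin| |].
  - rewrite (finlin c _ _ c0 (p0 f) (p0 g) (py f fy) (py g gy)).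
    by rewrite (finlin c _ _ c0 (n0 f) (n0 g) (ny f fy) (ny g gy)); ring.
  - exact: liny (p0 f) (p0 g) (py f fy) (py g gy).
  - exact: liny (n0 f) (n0 g) (ny f fy) (ny g gy).
(* A negative factor exchanges the two parts of [f]. *)
have {c0}c0 : 0 <= - c by lra.
transitivity (rsum D (fun i => (- c * n f i + p g i) - (- c * p f i + n g i))).
  by apply: eq_rsum => i _; rewrite /p /n; field.
rewrite rsumB_ge0; [|exact: ge0lin|exact: ge0lin| |].
- rewrite (finlin (- c) _ _ c0 (n0 f) (p0 g) (ny f fy) (py g gy)).
  by rewrite (finlin (- c) _ _ c0 (p0 f) (n0 g) (py f fy) (ny g gy)); ring.
- exact: liny (n0 f) (p0 g) (ny f fy) (py g gy).
- exact: liny (p0 f) (n0 g) (py f fy) (ny g gy).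
Qed.

Lemma abs_summable0 D : abs_summable D (fun=> 0).
Proof. by rewrite /abs_summable esum1// => i _; rewrite normr0. Qed.

Lemma rsum0 D : rsum D (fun=> 0) = 0.
Proof. by apply: EFin_inj; rewrite ge0_rsum ?esum1. Qed.

Lemma abs_summable_linear D c f g : abs_summable D f -> abs_summable D g ->
  abs_summable D (fun i => c * f i + g i).
Proof.
move=> fy gy; apply: (@abs_summable_le D _ (fun i => `|c| * `|f i| + `|g i|)).
  by move=> i _; rewrite (le_trans (ler_normD _ _))// normrM.
under eq_esum do rewrite EFinD.
by rewrite esumD// lte_add_pinfty// ge0_esumZl// lte_mul_pinfty.
Qed.

Lemma rsum_sum D (J : Type) (s : seq J) (c : J -> R) (F : J -> I -> R) :
  (forall j, abs_summable D (F j)) ->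
  rsum D (fun i => \sum_(j <- s) c j * F j i) = \sum_(j <- s) c j * rsum D (F j).
Proof.
move=> Fy.
suff [] : rsum D (fun i => \sum_(j <- s) c j * F j i) =
    \sum_(j <- s) c j * rsum D (F j) /\
    abs_summable D (fun i => \sum_(j <- s) c j * F j i) by [].
elim: s => [|j s [IH1 IH2]].
  rewrite big_nil; split; last first.
    by under eq_fun do rewrite big_nil; exact: abs_summable0.
  by rewrite -[RHS](rsum0 D); apply: eq_rsum => i _; rewrite big_nil.
rewrite big_cons -IH1 -rsum_linear//; split.
  by apply: eq_rsum => i _; rewrite big_cons.
by under eq_fun do rewrite big_cons; exact: abs_summable_linear.
Qed.

End real_sums.

Lemma exchange_esum {R : realType} (I J : choiceType) (D : set I) (E : set J)
    (F : I -> J -> \bar R) :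
  (forall i j, D i -> E j -> 0 <= F i j)%E ->
  \esum_(i in D) \esum_(j in E) F i j = \esum_(j in E) \esum_(i in D) F i j.
Proof.
move=> F0; rewrite !esum_esum//; last by move=> i j Ei Dj; exact: F0.
rewrite (reindex_esum (E `*`` fun=> D) _ (fun x => (x.2, x.1)))//; split=> //=.
- by move=> [i j] [].
- by move=> [i1 i2] [j1 j2] /= _ _ [-> ->].
- by move=> [i j] [/= Di Ej]; exists (j, i).
Qed.

(** * Semi-inner products and orthonormal bases *)

(** The form is only required to behave well on [H], and it may have null
    vectors: this is the situation of representatives of L^2 functions. *)
Record semi_inner_product {R : realType} {V : lmodType R} (H : set V)
    (ip : V -> V -> R) : Prop := SemiInnerProduct {
  sip0 : H 0;
  sip_closed : forall c u v, H u -> H v -> H (c *: u + v);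
  sipC : forall u v, ip u v = ip v u;
  sip_linear : forall c u v w, H u -> H v -> H w ->
    ip (c *: u + v) w = c * ip u w + ip v w;
  sip_ge0 : forall u, H u -> 0 <= ip u u }.

Section semi_inner_product.
Context {R : realType} {V : lmodType R} {H : set V} {ip : V -> V -> R}.
Hypothesis sip : semi_inner_product H ip.
Implicit Types u v w : V.

Let H0 := sip0 sip.
Let Hl := sip_closed sip.
Let ipC := sipC sip.
Let ipl := sip_linear sip.

Lemma sip_closedD u v : H u -> H v -> H (u + v).
Proof. by move=> Hu Hv; rewrite -[u]scale1r; exact: Hl. Qed.

Lemma sip_closedZ c u : H u -> H (c *: u).
Proof. by move=> Hu; rewrite -[_ *: _]addr0; exact: Hl. Qed.

Lemma sip_closedB u v : H u -> H v -> H (u - v).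
Proof. by move=> Hu Hv; rewrite addrC -scaleN1r; exact: Hl. Qed.

Lemma sip_closed_sum (I : eqType) (s : seq I) (c : I -> R) (F : I -> V) :
  (forall i, i \in s -> H (F i)) -> H (\sum_(i <- s) c i *: F i).
Proof.
elim: s => [|i s IHs] HF; first by rewrite big_nil.
rewrite big_cons; apply: Hl; first by apply: HF; rewrite inE eqxx.
by apply: IHs => j js; apply: HF; rewrite inE js orbT.
Qed.

Lemma sipD u v w : H u -> H v -> H w -> ip (u + v) w = ip u w + ip v w.
Proof. by move=> Hu Hv Hw; rewrite -[u]scale1r ipl// mul1r scale1r. Qed.

Lemma sip0l w : H w -> ip 0 w = 0.
Proof.
move=> Hw; have := sipD H0 H0 Hw; rewrite addr0 => /eqP.
by rewrite -subr_eq0 opprD addNKr oppr_eq0 => /eqP.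
Qed.

Lemma sipZ c u w : H u -> H w -> ip (c *: u) w = c * ip u w.
Proof. by move=> Hu Hw; rewrite -[_ *: _]addr0 ipl// sip0l// addr0. Qed.

Lemma sipB u v w : H u -> H v -> H w -> ip (u - v) w = ip u w - ip v w.
Proof. by move=> Hu Hv Hw; rewrite addrC -scaleN1r ipl// mulN1r addrC. Qed.

Lemma sipN u w : H u -> H w -> ip (- u) w = - ip u w.
Proof. by move=> Hu Hw; rewrite -scaleN1r sipZ// mulN1r. Qed.

Lemma sip_suml (I : eqType) (s : seq I) (c : I -> R) (F : I -> V) w :
  (forall i, i \in s -> H (F i)) -> H w ->
  ip (\sum_(i <- s) c i *: F i) w = \sum_(i <- s) c i * ip (F i) w.
Proof.
move=> HF Hw.
elim: s HF => [|i s IHs] HF; first by rewrite !big_nil sip0l.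
have HF' j : j \in s -> H (F j) by move=> js; apply: HF; rewrite inE js orbT.
rewrite !big_cons ipl ?IHs//; first by apply: HF; rewrite inE eqxx.
exact: sip_closed_sum.
Qed.

Lemma sip_sqrD u v : H u -> H v ->
  ip (u + v) (u + v) = ip u u + 2 * ip u v + ip v v.
Proof.
move=> Hu Hv; have Huv := sip_closedD Hu Hv.
by rewrite sipD// ![ip _ (u + v)]ipC !sipD// [ip v u]ipC; ring.
Qed.

Lemma sip_sqrB u v : H u -> H v ->
  ip (u - v) (u - v) = ip u u - 2 * ip u v + ip v v.
Proof.
move=> Hu Hv; have Huv := sip_closedB Hu Hv.
by rewrite sipB// ![ip _ (u - v)]ipC !sipB// [ip v u]ipC; ring.
Qed.

Lemma sip_sqrDle u v : H u -> H v ->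
  ip (u + v) (u + v) <= 2 * ip u u + 2 * ip v v.
Proof.
move=> Hu Hv; have := sip_ge0 sip (sip_closedB Hu Hv).
by rewrite sip_sqrB// sip_sqrD//; lra.
Qed.

Lemma sip_sqrBle u v : H u -> H v ->
  ip (u - v) (u - v) <= 2 * ip u u + 2 * ip v v.
Proof.
move=> Hu Hv; have := sip_ge0 sip (sip_closedD Hu Hv).
by rewrite sip_sqrB// sip_sqrD//; lra.
Qed.

(** A cheap substitute for the Cauchy-Schwarz inequality whose right-hand side can
    be summed over a basis. *)
Lemma norm_sip_le u v : H u -> H v -> `|ip u v| <= ip u u + ip v v.
Proof.
move=> Hu Hv; have := sip_ge0 sip (sip_closedD Hu Hv).
have := sip_ge0 sip (sip_closedB Hu Hv).
have := sip_ge0 sip Hu; have := sip_ge0 sip Hv.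
rewrite sip_sqrB// sip_sqrD// => u0 v0 h1 h2.
by rewrite ler_norml; apply/andP; split; lra.
Qed.

Lemma cauchy_schwarz u v : H u -> H v -> (ip u v) ^+ 2 <= ip u u * ip v v.
Proof.
move=> Hu Hv.
(* The squared norm of [c *: u + v], at two well-chosen values of [c]. *)
have q c : 0 <= c ^+ 2 * ip u u + 2 * c * ip u v + ip v v.
  have Hcu := sip_closedZ c Hu.
  have := sip_ge0 sip (sip_closedD Hcu Hv).
  rewrite sip_sqrD// (sipZ _ Hu Hcu) [ip u (c *: u)]ipC !sipZ//.
  by congr (0 <= _); ring.
have u0 := sip_ge0 sip Hu; have v0 := sip_ge0 sip Hv.
have [uu0|uu0] := eqVneq (ip u u) 0.
  have [->|uv0] := eqVneq (ip u v) 0; first by rewrite expr0n/= mulr_ge0.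
  (* A null [u] makes the form affine in [c]: this value would make it -1. *)
  have := q (- (ip v v + 1) / (2 * ip u v)).
  have -> : 2 * (- (ip v v + 1) / (2 * ip u v)) * ip u v = - (ip v v + 1).
    by field.
  by rewrite uu0 mulr0; lra.
have {uu0}u0 : 0 < ip u u by rewrite lt_def uu0.
have := q (- (ip u v) / ip u u).
have -> : (- ip u v / ip u u) ^+ 2 * ip u u + 2 * (- ip u v / ip u u) * ip u v
    + ip v v = (ip u u * ip v v - ip u v ^+ 2) / ip u u by field; lra.
by rewrite pmulr_lge0 ?invr_gt0// subr_ge0.
Qed.

Record onb (B : set V) : Prop := Onb {
  onb_sub : B `<=` H;
  onb_norm1 : forall e, B e -> ip e e = 1;
  onb_orthogonal : forall e e', B e -> B e' -> e <> e' -> ip e e' = 0;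
  onb_total : forall u, H u -> forall eps : R, 0 < eps ->
    exists n (e : 'I_n -> V) (c : 'I_n -> R), (forall i, B (e i)) /\
      ip (u - \sum_(i < n) c i *: e i) (u - \sum_(i < n) c i *: e i) < eps }.

Definition linear_on (phi : V -> R) := forall c u v, H u -> H v ->
  phi (c *: u + v) = c * phi u + phi v.

Lemma linear_on_sum phi (I : eqType) (s : seq I) (c : I -> R) (F : I -> V) :
  linear_on phi -> (forall i, i \in s -> H (F i)) ->
  phi (\sum_(i <- s) c i *: F i) = \sum_(i <- s) c i * phi (F i).
Proof.
move=> phil; elim: s => [_|i s IHs HF].
  rewrite !big_nil; have := phil 1 0 0 H0 H0.
  by rewrite scaler0 addr0 mul1r => /eqP; rewrite -subr_eq0 opprD addNKr
    oppr_eq0 => /eqP.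
have Hs j : j \in s -> H (F j) by move=> js; apply: HF; rewrite inE js orbT.
rewrite !big_cons phil ?IHs//; first by apply: HF; rewrite inE eqxx.
exact: sip_closed_sum.
Qed.

Section orthonormal.
Variables (B : set V).
Hypothesis oB : onb B.

Lemma onb_expand (F : seq V) (c : V -> R) : uniq F -> (forall e, e \in F -> B e) ->
  forall e, e \in F -> ip (\sum_(e' <- F) c e' *: e') e = c e.
Proof.
move=> uF FB e eF; rewrite sip_suml; last 2 first.
- by move=> i /FB /(onb_sub oB).
- exact/(onb_sub oB)/FB.
rewrite (bigD1_seq e)//= big_seq_cond big1 ?addr0.
  by rewrite (onb_norm1 oB) ?mulr1//; exact: FB.
by move=> i /andP[iF /eqP ie]; rewrite (onb_orthogonal oB) ?mulr0//; exact: FB.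
Qed.

Lemma onb_sqr (F : seq V) (c : V -> R) : uniq F -> (forall e, e \in F -> B e) ->
  ip (\sum_(e <- F) c e *: e) (\sum_(e <- F) c e *: e) = \sum_(e <- F) c e ^+ 2.
Proof.
move=> uF FB; rewrite sip_suml; last 2 first.
- by move=> i /FB /(onb_sub oB).
- by apply: sip_closed_sum => i /FB /(onb_sub oB).
by apply: eq_big_seq => e eF; rewrite ipC onb_expand.
Qed.

(** Among the combinations of finitely many basis vectors, the orthogonal
    projection is the closest to [u]. *)
Lemma onb_projection (F : seq V) (u : V) (J : eqType) (s : seq J) (c : J -> R)
    (E : J -> V) : uniq F -> (forall e, e \in F -> B e) -> H u ->
  (forall j, E j \in F) ->
  ip (u - \sum_(e <- F) ip u e *: e) (u - \sum_(e <- F) ip u e *: e) <=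
  ip (u - \sum_(j <- s) c j *: E j) (u - \sum_(j <- s) c j *: E j).
Proof.
move=> uF FB Hu EF.
have HF e : e \in F -> H e by move=> /FB /(onb_sub oB).
set p := \sum_(e <- F) ip u e *: e; set w := \sum_(j <- s) _.
have Hp : H p by exact: sip_closed_sum.
have Hw : H w by apply: sip_closed_sum => j _; exact: HF.
have Hup := sip_closedB Hu Hp; have Hpw := sip_closedB Hp Hw.
have upF e : e \in F -> ip e (u - p) = 0.
  by move=> eF; rewrite ipC sipB//; [rewrite onb_expand// subrr|exact: HF].
have ortho : ip (u - p) (p - w) = 0.
  rewrite ipC sipB// /p /w !sip_suml//; last by move=> j _; exact: HF.
  rewrite big_seq big1 => [|e eF]; last by rewrite upF// mulr0.
  by rewrite big1 ?subr0// => j _; rewrite upF// mulr0.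
have -> : u - w = (u - p) + (p - w) by rewrite addrA subrK.
by rewrite (sip_sqrD Hup Hpw) ortho mulr0 addr0 lerDl (sip_ge0 sip).
Qed.

(** Bessel's inequality for a functional: on the finite combination with
    coefficients [phi e], both [phi] and the squared norm equal the partial sum. *)
Lemma onb_functional_le (phi : V -> R) (S : R) : linear_on phi -> 0 <= S ->
  (forall u, H u -> phi u ^+ 2 <= ip u u * S) ->
  (\esum_(e in B) (phi e ^+ 2)%:E <= S%:E)%E.
Proof.
move=> phil S0 phiS; apply: ge_ereal_sup => _ [X [fX XB] <-].
rewrite fsumEFin// lee_fin fsbig_finite//.
set F := (fset_set X : seq V).
have FB e : e \in F -> B e by rewrite in_fset_set// => /set_mem /XB.
have uF : uniq F by exact: fset_uniq.
have HF e : e \in F -> H e by move=> /FB /(onb_sub oB).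
set s := \sum_(e <- F) _.
have s0 : 0 <= s by apply: sumr_ge0 => e _; exact: sqr_ge0.
have := phiS _ (sip_closed_sum phi HF).
rewrite linear_on_sum// onb_sqr//.
rewrite (_ : \sum_(e <- F) phi e * phi e = s)//.
have [->|sn0] := eqVneq s 0; last by rewrite expr2 ler_pM2l// lt_def sn0.
by rewrite expr0n.
Qed.

(** The converse bound: by totality [phi u] is approximated by [phi p] with [p]
    the projection of [u] on finitely many basis vectors, and [phi p] is the
    inner product of [u] with the combination with coefficients [phi e]. *)
Lemma functional_le_onb (phi : V -> R) (C S : R) (u : V) : linear_on phi ->
  (forall v, H v -> phi v ^+ 2 <= C * ip v v) ->
  (\esum_(e in B) (phi e ^+ 2)%:E <= S%:E)%E ->
  H u -> phi u ^+ 2 <= ip u u * S.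
Proof.
move=> phil phiC phiS Hu.
have u0 := sip_ge0 sip Hu.
have S0 : 0 <= S.
  by rewrite -lee_fin (le_trans _ phiS)// esum_ge0// => e _; rewrite lee_fin sqr_ge0.
set b := Num.sqrt (ip u u * S).
suff ub : `|phi u| <= b.
  by rewrite -real_normK ?num_real// -[leRHS]sqr_sqrtr ?mulr_ge0// ler_sqr ?nnegrE.
apply/ler_addgt0Pr => d d0.
(* With this precision, [phi] varies by at most [d] between [u] and [p]. *)
have C1 : 0 < `|C| + 1 by rewrite ltr_wpDl.
have eps0 : 0 < d ^+ 2 / (`|C| + 1) by rewrite divr_gt0// exprn_gt0.
have [n [e [c [Be ule]]]] := onb_total oB Hu eps0.
(* The [e i] may repeat, whereas orthogonality is between distinct vectors. *)
pose F := undup (codom e).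
have uF : uniq F by exact: undup_uniq.
have eF i : e i \in F by rewrite mem_undup codom_f.
have FB x : x \in F -> B x by rewrite mem_undup => /codomP[i ->].
have HF x : x \in F -> H x by move=> /FB /(onb_sub oB).
set p := \sum_(x <- F) ip u x *: x.
have Hp : H p by exact: sip_closed_sum.
have pe := le_lt_trans (onb_projection (index_enum 'I_n) c uF FB Hu eF) ule.
have -> : u = 1 *: p + (u - p) by rewrite scale1r addrC subrK.
have Hup := sip_closedB Hu Hp.
rewrite phil// mul1r (le_trans (ler_normD _ _))// lerD//.
  pose v := \sum_(x <- F) phi x *: x.
  have Hv : H v by exact: sip_closed_sum.
  have -> : phi p = ip u v.
    rewrite linear_on_sum// ipC sip_suml//.
    by apply: eq_bigr => x _; rewrite mulrC ipC.
  rewrite -sqrtr_sqr ler_wsqrtr// (le_trans (cauchy_schwarz Hu Hv))//.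
  rewrite ler_wpM2l// onb_sqr// -lee_fin (le_trans _ phiS)//.
  apply: esum_ge; exists [set` F].
    by split; [exact: finite_seq|move=> x /FB].
  rewrite fsumEFin; last exact: finite_seq.
  by rewrite -fsbig_seq.
rewrite -(ler_sqr (x:=`|_|)) ?nnegrE ?(ltW d0)// real_normK ?num_real//.
rewrite (le_trans (phiC _ Hup))// (le_trans (ler_wpM2r (sip_ge0 sip Hup) (ler_norm C)))//.
rewrite (@le_trans _ _ ((`|C| + 1) * (d ^+ 2 / (`|C| + 1))))//; last first.
  by rewrite mulrC divfK// gt_eqF.
by apply: ler_pM => //; [exact: sip_ge0 Hup|lra|exact: ltW].
Qed.

End orthonormal.

(** By the two bounds above, the sum is the squared operator norm of the
    functional, which does not see the basis. *)
Lemma onb_functional_indep (B B' : set V) (phi : V -> R) (C : R) :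
  onb B -> onb B' -> linear_on phi ->
  (forall v, H v -> phi v ^+ 2 <= C * ip v v) ->
  \esum_(e in B) (phi e ^+ 2)%:E = \esum_(e in B') (phi e ^+ 2)%:E.
Proof.
move=> oB oB' phil phiC.
gen have le_indep : B B' oB oB' / (\esum_(e in B) (phi e ^+ 2)%:E <=
    \esum_(e in B') (phi e ^+ 2)%:E)%E; last by apply/eqP; rewrite eq_le !le_indep.
have S0 : (0 <= \esum_(e in B') (phi e ^+ 2)%:E)%E.
  by rewrite esum_ge0// => e _; rewrite lee_fin sqr_ge0.
case ES : (\esum_(e in B') (phi e ^+ 2)%:E)%E S0 => [S| |//] S0; last first.
  by rewrite leey.
apply: onb_functional_le => // u Hu.
by apply: (functional_le_onb oB' phil phiC) => //; rewrite ES.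
Qed.

(** The case [phi = ip u] of the two bounds: the norm of this functional is that of
    [u] by the Cauchy-Schwarz inequality. *)
Lemma parseval (B : set V) (u : V) : onb B -> H u ->
  \esum_(e in B) (ip u e ^+ 2)%:E = (ip u u)%:E.
Proof.
move=> oB Hu.
have phil : linear_on (ip u).
  by move=> c v w Hv Hw; rewrite ipC ipl// ![ip _ u]ipC.
have cs v : H v -> ip u v ^+ 2 <= ip u u * ip v v by exact: cauchy_schwarz.
have u0 := sip_ge0 sip Hu.
apply/eqP; rewrite eq_le; apply/andP; split.
  by apply: onb_functional_le => // v Hv; rewrite mulrC cs.
case ES : (\esum_(e in B) (ip u e ^+ 2)%:E)%E => [S| |]; last 2 first.
- by rewrite leey.
- have : (0 <= \esum_(e in B) (ip u e ^+ 2)%:E)%E.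
    by rewrite esum_ge0// => e _; rewrite lee_fin sqr_ge0.
  by rewrite ES.
have := functional_le_onb oB phil cs (S := S).
rewrite ES lexx => /(_ u isT Hu); rewrite lee_fin expr2.
have [->|n0] := eqVneq (ip u u) 0; last by rewrite ler_pM2l// lt_def n0.
have : (0 <= \esum_(e in B) (ip u e ^+ 2)%:E)%E.
  by rewrite esum_ge0// => e _; rewrite lee_fin sqr_ge0.
by rewrite ES lee_fin.
Qed.


(** * Hilbert-Schmidt operators *)

(** Linearity is only tested against vectors of [H], so that an operator need
    only be linear up to null vectors. *)
Record bounded_operator (A : V -> V) : Prop := BoundedOperator {
  bop_closed : forall u, H u -> H (A u);
  bop_linear : forall c u v w, H u -> H v -> H w ->
    ip (A (c *: u + v)) w = c * ip (A u) w + ip (A v) w;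
  bop_bound : exists C, forall u, H u -> ip (A u) (A u) <= C * ip u u }.

Lemma bounded_operator_ge0 A : bounded_operator A ->
  exists2 C, 0 <= C & forall u, H u -> ip (A u) (A u) <= C * ip u u.
Proof.
case=> _ _ [C AC]; exists `|C| => // u Hu.
by rewrite (le_trans (AC _ Hu))// ler_wpM2r ?ler_norm// (sip_ge0 sip).
Qed.

Lemma bounded_operatorD A A' : bounded_operator A -> bounded_operator A' ->
  bounded_operator (fun u => A u + A' u).
Proof.
move=> bA bA'; have [C _ AC] := bounded_operator_ge0 bA.
have [C' _ AC'] := bounded_operator_ge0 bA'.
have HA := bop_closed bA; have HA' := bop_closed bA'.
split=> [u Hu|c u v w Hu Hv Hw|]; first exact: sip_closedD (HA _ Hu) (HA' _ Hu).
  have Huv := Hl c Hu Hv.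
  rewrite (sipD (HA _ Huv) (HA' _ Huv) Hw) (sipD (HA _ Hu) (HA' _ Hu) Hw).
  rewrite (sipD (HA _ Hv) (HA' _ Hv) Hw).
  by rewrite (bop_linear bA)// (bop_linear bA')//; ring.
exists (2 * C + 2 * C') => u Hu.
rewrite (le_trans (sip_sqrDle (HA _ Hu) (HA' _ Hu)))//.
by have := AC _ Hu; have := AC' _ Hu; lra.
Qed.

Lemma bounded_operatorN A : bounded_operator A -> bounded_operator (fun u => - A u).
Proof.
move=> bA; have [C _ AC] := bounded_operator_ge0 bA.
have HA := bop_closed bA.
have HN u : H u -> H (- A u).
  by move=> Hu; rewrite -scaleN1r; apply: sip_closedZ; exact: HA.
split=> [//|c u v w Hu Hv Hw|].
- rewrite (sipN (HA _ (Hl c Hu Hv)) Hw) (sipN (HA _ Hu) Hw) (sipN (HA _ Hv) Hw).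
  by rewrite (bop_linear bA)//; ring.
- exists C => u Hu; have Hu' := HA _ Hu.
  by rewrite (sipN Hu' (HN _ Hu)) ipC (sipN Hu' Hu') opprK AC.
Qed.

Lemma bounded_operatorB A A' : bounded_operator A -> bounded_operator A' ->
  bounded_operator (fun u => A u - A' u).
Proof. by move=> bA /bounded_operatorN; exact: bounded_operatorD. Qed.

Definition hs (B : set V) (A : V -> V) : \bar R :=
  \esum_(e in B) (ip (A e) (A e))%:E.

(** Expanding the vectors [A f] in the basis [B] and exchanging the sums turns the
    norm, in any basis, into the sum over [B] of the squared norms of the
    functionals [ip (A _) e]; this avoids the adjoint of [A]. *)
Lemma hs_indep B B' A : onb B -> onb B' -> bounded_operator A -> hs B A = hs B' A.
Proof.
move=> oB oB' bA; have HA := bop_closed bA.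
have [C C0 AC] := bounded_operator_ge0 bA.
have hsE B1 : onb B1 ->
    hs B1 A = \esum_(e in B) \esum_(f in B1) (ip (A f) e ^+ 2)%:E.
  move=> oB1; rewrite exchange_esum; last by move=> *; rewrite lee_fin sqr_ge0.
  by apply: eq_esum => e /(onb_sub oB1) He; rewrite parseval//; exact: HA.
rewrite (hsE B)// (hsE B')//; apply: eq_esum => f Bf.
have Hf := onb_sub oB Bf.
apply: (onb_functional_indep (C := C)) => // [c u v Hu Hv|u Hu].
  exact: bop_linear bA _ _ _ _ Hu Hv Hf.
rewrite (le_trans (cauchy_schwarz (HA _ Hu) Hf))// (onb_norm1 oB Bf) mulr1.
exact: AC.
Qed.

(** The inverse is part of the data since it is the adjoint, which is needed
    explicitly. *)
Record unitary (U U' : V -> V) : Prop := Unitary {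
  uni_linear : forall c u v, U (c *: u + v) = c *: U u + U v;
  uni_closed : forall u, H u -> H (U u);
  uni_closedV : forall u, H u -> H (U' u);
  uni_sip : forall u v, H u -> H v -> ip (U u) (U v) = ip u v;
  uniK : cancel U U';
  uniVK : cancel U' U }.

Lemma unitary_sum U U' (I : Type) (s : seq I) (c : I -> R) (F : I -> V) :
  unitary U U' -> U (\sum_(i <- s) c i *: F i) = \sum_(i <- s) c i *: U (F i).
Proof.
move=> uU; elim: s => [|i s IHs]; last by rewrite !big_cons (uni_linear uU) IHs.
rewrite !big_nil; have := uni_linear uU 1 0 0; rewrite !scale1r addr0 => /eqP.
by rewrite -subr_eq0 opprD addNKr oppr_eq0 => /eqP.
Qed.

Lemma onb_unitary U U' B : unitary U U' -> onb B -> onb (U @` B).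
Proof.
move=> uU oB; have HB := onb_sub oB; split.
- by move=> _ [e Be <-]; apply: (uni_closed uU); exact: HB.
- by move=> _ [e Be <-]; rewrite (uni_sip uU) ?(onb_norm1 oB)//; exact: HB.
- move=> _ _ [e Be <-] [e' Be' <-] ee'.
  rewrite (uni_sip uU) ?(onb_orthogonal oB)//; [|exact: HB|exact: HB].
  by move=> /(congr1 U).
- move=> u Hu eps eps0.
  have Hu' := uni_closedV uU Hu.
  have [n [e [c [Be ule]]]] := onb_total oB Hu' eps0.
  exists n, (U \o e), c; split; first by move=> i; exists (e i).
  have Hs : H (\sum_(i < n) c i *: e i) by apply: sip_closed_sum => i _; exact: HB.
  have -> : u - \sum_(i < n) c i *: U (e i) = U (U' u - \sum_(i < n) c i *: e i).
    rewrite -(unitary_sum _ _ _ uU) -[X in X - _](uniVK uU).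
    by rewrite -scaleN1r addrC -(uni_linear uU) scaleN1r addrC.
  by rewrite (uni_sip uU)//; exact: sip_closedB.
Qed.

(** The left factor preserves every norm in the sum; the right one replaces the
    basis by its image. *)
Lemma hs_conj B A U U' W W' : onb B -> bounded_operator A ->
  unitary U U' -> unitary W W' -> hs B (fun u => U (A (W u))) = hs B A.
Proof.
move=> oB bA uU uW; rewrite -(hs_indep (onb_unitary uW oB) oB bA).
rewrite {2}/hs esum_image; last by move=> e e' _ _; exact: (can_inj (uniK uW)).
apply: eq_esum => e /(onb_sub oB) He.
by rewrite (uni_sip uU)//; apply: (bop_closed bA); exact: uni_closed uW _ He.
Qed.

Lemma bounded_operator_conj A U U' W W' : bounded_operator A ->
  unitary U U' -> unitary W W' -> bounded_operator (fun u => U (A (W u))).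
Proof.
move=> bA uU uW; have [C _ AC] := bounded_operator_ge0 bA.
have HA := bop_closed bA; have HU := uni_closed uU; have HW := uni_closed uW.
split=> [u Hu|c u v w Hu Hv Hw|]; first exact/HU/HA/HW.
  have Hw' := uni_closedV uU Hw; have UA x : H x ->
      ip (U (A (W x))) w = ip (A (W x)) (U' w).
    by move=> Hx; rewrite -{1}(uniVK uU w) (uni_sip uU)//; exact/HA/HW.
  rewrite !UA//; last exact: Hl.
  by rewrite (uni_linear uW) (bop_linear bA)//; exact: HW.
exists C => u Hu; rewrite (uni_sip uU); do ?exact/HA/HW.
by rewrite (le_trans (AC _ _)) ?(uni_sip uW)//; exact: HW.
Qed.

Section hs_inner_product.
Variables (B : set V).
Hypothesis oB : onb B.

Record hs_operator (A : V -> V) : Prop := HsOperator {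
  hs_bounded : bounded_operator A;
  hs_finite : (hs B A < +oo)%E }.

Definition hsip (S T : V -> V) : R := rsum B (fun e => ip (S e) (T e)).

Let HA S e : hs_operator S -> B e -> H (S e).
Proof. by move=> [bS _] /(onb_sub oB); exact: bop_closed bS _. Qed.

Lemma hsip_hs S : hs_operator S -> (hsip S S)%:E = hs B S.
Proof.
move=> hS; rewrite /hsip ge0_rsum ?(hs_finite hS)// => e Be.
by rewrite (sip_ge0 sip)//; exact: HA.
Qed.

Lemma hs_combine_lty S T A : hs_operator S -> hs_operator T ->
  (forall e, B e -> ip (A e) (A e) <= 2 * ip (S e) (S e) + 2 * ip (T e) (T e)) ->
  (hs B A < +oo)%E.
Proof.
move=> hS hT Ale.
have nS e : B e -> 0 <= ip (S e) (S e) by move=> /(HA hS); exact: sip_ge0.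
have nT e : B e -> 0 <= ip (T e) (T e) by move=> /(HA hT); exact: sip_ge0.
apply: (@le_lt_trans _ _ (2%:E * hs B S + 2%:E * hs B T)%E).
  rewrite /hs -!ge0_esumZl// -esumD; last 2 first.
  - by move=> e Be; rewrite lee_fin mulr_ge0 ?nS.
  - by move=> e Be; rewrite lee_fin mulr_ge0 ?nT.
  by apply: le_esum => e Be; rewrite -EFinD lee_fin Ale.
by rewrite lte_add_pinfty// lte_mul_pinfty// ?(hs_finite hS) ?(hs_finite hT).
Qed.

Lemma hs_operatorD S T : hs_operator S -> hs_operator T ->
  hs_operator (fun u => S u + T u).
Proof.
move=> hS hT; split; first by apply: bounded_operatorD; exact: hs_bounded.
by apply: (hs_combine_lty hS hT) => e Be; apply: sip_sqrDle; exact: HA.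
Qed.

Lemma hs_operatorB S T : hs_operator S -> hs_operator T ->
  hs_operator (fun u => S u - T u).
Proof.
move=> hS hT; split; first by apply: bounded_operatorB; exact: hs_bounded.
by apply: (hs_combine_lty hS hT) => e Be; apply: sip_sqrBle; exact: HA.
Qed.

Lemma hs_operator_conj A U U' W W' : hs_operator A ->
  unitary U U' -> unitary W W' -> hs_operator (fun u => U (A (W u))).
Proof.
move=> [bA fA] uU uW; split; first exact: bounded_operator_conj bA uU uW.
by rewrite (hs_conj oB bA uU uW).
Qed.

Lemma hsip_summable S T : hs_operator S -> hs_operator T ->
  abs_summable B (fun e => ip (S e) (T e)).
Proof.
move=> hS hT.
apply: (abs_summable_le (g := fun e => ip (S e) (S e) + ip (T e) (T e))).
  by move=> e Be; apply: norm_sip_le; exact: HA.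
under eq_esum do rewrite EFinD.
rewrite esumD; first exact: lte_add_pinfty (hs_finite hS) (hs_finite hT).
- by move=> e Be; rewrite lee_fin (sip_ge0 sip)//; exact: HA.
- by move=> e Be; rewrite lee_fin (sip_ge0 sip)//; exact: HA.
Qed.

Lemma hsipC S T : hsip S T = hsip T S.
Proof. by apply: eq_rsum => e _; rewrite ipC. Qed.

Lemma hsipD S S' T : hs_operator S -> hs_operator S' -> hs_operator T ->
  hsip (fun u => S u + S' u) T = hsip S T + hsip S' T.
Proof.
move=> hS hS' hT; rewrite -[hsip S T]mul1r -rsum_linear; do ?exact: hsip_summable.
by apply: eq_rsum => e Be; rewrite mul1r sipD//; exact: HA.
Qed.

Lemma hsipB S S' T : hs_operator S -> hs_operator S' -> hs_operator T ->
  hsip (fun u => S u - S' u) T = hsip S T - hsip S' T.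
Proof.
move=> hS hS' hT; rewrite addrC -mulN1r -rsum_linear; do ?exact: hsip_summable.
by apply: eq_rsum => e Be; rewrite mulN1r [RHS]addrC sipB//; exact: HA.
Qed.

Lemma hs_sqrD S T : hs_operator S -> hs_operator T ->
  hsip (fun u => S u + T u) (fun u => S u + T u) =
    hsip S S + 2 * hsip S T + hsip T T.
Proof.
move=> hS hT; have hST := hs_operatorD hS hT.
set A := (fun u => S u + T u) in hST *.
have AE X : hs_operator X -> hsip A X = hsip S X + hsip T X by exact: hsipD.
by rewrite (AE _ hST) (hsipC S A) (hsipC T A) !AE// (hsipC T S); ring.
Qed.

Lemma hs_sqrB S T : hs_operator S -> hs_operator T ->
  hsip (fun u => S u - T u) (fun u => S u - T u) =
    hsip S S - 2 * hsip S T + hsip T T.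
Proof.
move=> hS hT; have hST := hs_operatorB hS hT.
set A := (fun u => S u - T u) in hST *.
have AE X : hs_operator X -> hsip A X = hsip S X - hsip T X by exact: hsipB.
by rewrite (AE _ hST) (hsipC S A) (hsipC T A) !AE// (hsipC T S); ring.
Qed.

(** The norm of [U S W + T] is that of its conjugate [S + U' T W'], and likewise
    for differences; polarization turns this into an adjunction. *)
Lemma hsip_conj S T U U' W W' : hs_operator S -> hs_operator T ->
  unitary U U' -> unitary W W' -> unitary U' U -> unitary W' W ->
  hsip (fun u => U (S (W u))) T = hsip S (fun u => U' (T (W' u))).
Proof.
move=> hS hT uU uW uU' uW'.
have hS' := hs_operator_conj hS uU uW; have hT' := hs_operator_conj hT uU' uW'.
set S' := (fun u => U _) in hS' *; set T' := (fun u => U' _) in hT' *.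
have eD : hsip (fun u => S' u + T u) (fun u => S' u + T u) =
    hsip (fun u => S u + T' u) (fun u => S u + T' u).
  apply: EFin_inj; rewrite !hsip_hs; do ?exact: hs_operatorD.
  rewrite -(hs_conj oB (hs_bounded (hs_operatorD hS hT')) uU uW).
  apply: eq_esum => e _; rewrite /T' -[S (W e)]scale1r (uni_linear uU).
  by rewrite (uniVK uU) (uniK uW) !scale1r.
have eB : hsip (fun u => S' u - T u) (fun u => S' u - T u) =
    hsip (fun u => S u - T' u) (fun u => S u - T' u).
  apply: EFin_inj; rewrite !hsip_hs; do ?exact: hs_operatorB.
  rewrite -(hs_conj oB (hs_bounded (hs_operatorB hS hT')) uU uW).
  apply: eq_esum => e _; rewrite /T' addrC -scaleN1r.
  by rewrite [in RHS]addrC -[- U' _]scaleN1r (uni_linear uU) (uniVK uU) (uniK uW).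
move: eD eB; rewrite (hs_sqrD hS' hT) (hs_sqrD hS hT').
by rewrite (hs_sqrB hS' hT) (hs_sqrB hS hT'); lra.
Qed.

End hs_inner_product.

(** * Averages of conjugates *)

(** The operators [U i] and [W i] are indexed by a finite type with an inversion, as
    are the translations by pairs of group elements, and [p] is a probability
    distribution that is symmetric under the inversion. *)
Section twirl.
Variables (I : finType) (p : I -> R) (i_inv : I -> I) (U W : I -> V -> V).
Hypothesis p0 : forall i, 0 <= p i.
Hypothesis p1 : \sum_i p i = 1.
Hypothesis p_inv : forall i, p (i_inv i) = p i.
Hypothesis i_invK : involutive i_inv.
Hypothesis uU : forall i, unitary (U i) (U (i_inv i)).
Hypothesis uW : forall i, unitary (W i) (W (i_inv i)).

(** [A'] is the average of the conjugates of [A], up to null vectors. *)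
Definition twirl_of (A A' : V -> V) := forall u w, H u -> H w ->
  ip (A' u) w = \sum_i p i * ip (U i (A (W i u))) w.

(** Convexity of the squared norm: the variance of the conjugates is
    nonnegative. *)
Lemma twirl_sqr_le A A' u : twirl_of A A' -> (forall i, H (U i (A (W i u)))) ->
  H u -> H (A' u) ->
  ip (A' u) (A' u) <= \sum_i p i * ip (U i (A (W i u))) (U i (A (W i u))).
Proof.
move=> tA Hi Hu HAu.
have : 0 <= \sum_i p i * ip (A' u - U i (A (W i u))) (A' u - U i (A (W i u))).
  apply: sumr_ge0 => i _; rewrite mulr_ge0// (sip_ge0 sip)//.
  exact: sip_closedB.
rewrite (eq_bigr (fun i => p i * ip (A' u) (A' u) - 2 * (p i * ip (U i (A (W i u))) (A' u))
    + p i * ip (U i (A (W i u))) (U i (A (W i u))))); last first.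
  by move=> i _; rewrite sip_sqrB// [ip (A' u) (U i _)]ipC; ring.
rewrite big_split/= sumrB -mulr_suml p1 mul1r -mulr_sumr -tA//.
by lra.
Qed.

Lemma twirl_bounded A A' : bounded_operator A -> twirl_of A A' ->
  (forall u, H u -> H (A' u)) -> bounded_operator A'.
Proof.
move=> bA tA HA'; have [C C0 AC] := bounded_operator_ge0 bA.
have bi i := bounded_operator_conj bA (uU i) (uW i).
split=> // [c u v w Hu Hv Hw|].
  rewrite !tA//; last exact: Hl.
  rewrite mulr_sumr -big_split/=; apply: eq_bigr => i _.
  by rewrite (bop_linear (bi i))//; ring.
exists C => u Hu.
rewrite (le_trans (twirl_sqr_le tA _ Hu (HA' _ Hu)))//.
  by move=> i; exact: bop_closed (bi i) _ Hu.
rewrite -[leRHS]mul1r -p1 mulr_suml ler_sum// => i _.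
have HW := uni_closed (uW i) Hu.
rewrite ler_wpM2l// (uni_sip (uU i)); do ?exact: bop_closed bA _ HW.
by rewrite (le_trans (AC _ HW))// (uni_sip (uW i)).
Qed.

Lemma twirl_hs B A A' : onb B -> hs_operator B A -> twirl_of A A' ->
  (forall u, H u -> H (A' u)) -> hs_operator B A'.
Proof.
move=> oB hA tA HA'; split; first exact: twirl_bounded (hs_bounded hA) tA HA'.
have hi i := hs_operator_conj oB hA (uU i) (uW i).
have Hi i u : H u -> H (U i (A (W i u))) by exact: bop_closed (hs_bounded (hi i)) _.
apply: (@le_lt_trans _ _ (\sum_i (p i)%:E * hs B A)%E); last first.
  rewrite -ge0_sume_distrl => [|i _]; last by rewrite lee_fin.
  by rewrite sumEFin p1 mul1e (hs_finite hA).
rewrite (eq_bigr (fun i => \esum_(e in B) (p i * ip (U i (A (W i e))) (U i (A (W i e))))%:E)).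
  rewrite -esum_sum => [|e i /(onb_sub oB) He _].
    apply: le_esum => e /(onb_sub oB) He; rewrite sumEFin lee_fin.
    by apply: twirl_sqr_le => //; [move=> i; exact: Hi|exact: HA'].
  by rewrite lee_fin mulr_ge0// (sip_ge0 sip)//; exact: Hi.
move=> i _; rewrite ge0_esumZl//.
  by rewrite -(hs_conj oB (hs_bounded hA) (uU i) (uW i)).
by move=> e /(onb_sub oB) He; rewrite (sip_ge0 sip)//; exact: Hi.
Qed.

(** Moving the conjugations from [P] to [D] inverts the index, which leaves the
    weights unchanged, and averaging the conjugates of [D] gives [D] back. *)
Lemma hsip_twirl B P Q D : onb B -> hs_operator B P -> hs_operator B Q ->
  hs_operator B D -> twirl_of P Q -> twirl_of D D -> hsip B Q D = hsip B P D.
Proof.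
move=> oB hP hQ hD tP tD.
have HH S e : hs_operator B S -> B e -> H (S e).
  by move=> hS /(onb_sub oB); exact: bop_closed (hs_bounded hS) _.
have uU' i : unitary (U (i_inv i)) (U i) by rewrite -{2}(i_invK i); exact: uU.
have uW' i : unitary (W (i_inv i)) (W i) by rewrite -{2}(i_invK i); exact: uW.
transitivity (\sum_i p i * hsip B (fun u => U i (P (W i u))) D).
  rewrite -rsum_sum => [|i]; last first.
    exact: (hsip_summable oB (hs_operator_conj oB hP (uU i) (uW i)) hD).
  by apply: eq_rsum => e Be; rewrite tP//; [exact: onb_sub oB _ Be|exact: HH].
transitivity (\sum_i p i * hsip B (fun u => U i (D (W i u))) P).
  rewrite (reindex_inj (inv_inj i_invK)); apply: eq_bigr => i _.
  by rewrite p_inv (hsip_conj oB hP hD (uU' i) (uW' i) (uU i) (uW i)) hsipC.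
rewrite [RHS]hsipC -rsum_sum => [|i]; last first.
  exact: (hsip_summable oB (hs_operator_conj oB hD (uU i) (uW i)) hP).
by apply: eq_rsum => e Be; rewrite [RHS]tD//; [exact: onb_sub oB _ Be|exact: HH].
Qed.

Lemma hs_twirl_pythagoras B P Q M : onb B -> hs_operator B P -> hs_operator B M ->
  hs_operator B Q -> twirl_of P Q -> twirl_of Q Q -> twirl_of M M ->
  (hs B (fun u => P u - M u)%R =
   hs B (fun u => P u - Q u)%R + hs B (fun u => Q u - M u)%R)%E.
Proof.
move=> oB hP hM hQ tP tQ tM.
have hPQ := hs_operatorB oB hP hQ; have hQM := hs_operatorB oB hQ hM.
have tQM : twirl_of (fun u => Q u - M u) (fun u => Q u - M u).
  move=> u w Hu Hw.
  have HQ := bop_closed (hs_bounded hQ); have HM := bop_closed (hs_bounded hM).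
  rewrite sipB//; [|exact: HQ|exact: HM].
  rewrite tQ// tM// -sumrB; apply: eq_bigr => i _.
  have HWu := uni_closed (uW i) Hu.
  have UB x y : U i (x - y) = U i x - U i y.
    by rewrite addrC -scaleN1r (uni_linear (uU i)) scaleN1r addrC.
  by rewrite UB sipB ?mulrBr//; apply: (uni_closed (uU i)); [exact: HQ|exact: HM].
have orth : hsip B (fun u => P u - Q u) (fun u => Q u - M u) = 0.
  by rewrite hsipB// (hsip_twirl oB hP hQ hQM)// subrr.
rewrite -!hsip_hs//; last exact: hs_operatorB.
rewrite -EFinD; congr EFin.
transitivity (hsip B (fun u => (P u - Q u) + (Q u - M u))
                    (fun u => (P u - Q u) + (Q u - M u))).
  by apply: eq_rsum => e _; rewrite subrKA.
by rewrite (hs_sqrD oB hPQ hQM) orth mulr0 addr0.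
Qed.

End twirl.

End semi_inner_product.

Arguments onb {R V} H ip B.
Arguments bounded_operator {R V} H ip A.
Arguments hs {R V} ip B A.
Arguments unitary {R V} H ip U U'.
Arguments hs_operator {R V} H ip B A.
Arguments twirl_of {R V} H ip {I} p U W A A'.

(** * The space of square-integrable functions *)

Lemma integrable_scale {R : realType} {d} {T : measurableType d}
    {mu : {measure set T -> \bar R}} (c : R) (f : T -> R) :
  mu.-integrable setT (EFin \o f) ->
  mu.-integrable setT (EFin \o (fun x => c * f x)).
Proof. exact: (integrableZl measurableT). Qed.

Section L2.
Context {R : realType} {d} {T : measurableType d}.
Variable pi : probability T R.
Implicit Types f g : T -> R.

(** Square-integrable functions, without passing to classes modulo null sets; the
    null vectors of [L2ip] are the functions that vanish almost everywhere. *)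
Definition L2 : set (T -> R) := [set f | f \in Lfun pi 2%:E].

Definition L2ip f g : R := \int[pi]_x (f x * g x).

Lemma L2_measurable f : L2 f -> measurable_fun setT f.
Proof. by move=> /sub_Lfun_mfun; rewrite inE. Qed.

Lemma L2_mul_integrable f g : L2 f -> L2 g ->
  pi.-integrable setT (EFin \o (fun x => f x * g x)).
Proof. by move=> Lf Lg; apply/Lfun1_integrable; exact: Lfun2_mul_Lfun1. Qed.

Lemma L2_sip : semi_inner_product L2 L2ip.
Proof.
have [L0 Ll] := @Lfun_submod_closed _ _ _ pi 2%:E (lee1n 2).
split => //.
- by move=> u v; apply: eq_Rintegral => x _; rewrite mulrC.
- move=> c u v w Lu Lv Lw; rewrite /L2ip -RintegralZl//; last first.
    exact: L2_mul_integrable.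
  rewrite -RintegralD//; [|exact/(integrable_scale c)/L2_mul_integrable
                           |exact: L2_mul_integrable].
  by apply: eq_Rintegral => x _; rewrite mulrDl mulrA.
- by move=> u _; apply: Rintegral_ge0 => x _; rewrite -expr2 sqr_ge0.
Qed.

Lemma L2_integral_sqr f : L2 f -> (\int[pi]_x (f x ^+ 2)%:E)%E = (L2ip f f)%:E.
Proof.
move=> Lf; rewrite /L2ip /Rintegral fineK; last first.
  by apply: integrable_fin_num => //; exact: L2_mul_integrable.
by apply: eq_integral => x _; rewrite expr2.
Qed.

Lemma L2normE f : L2norm pi f = ((\int[pi]_x (f x ^+ 2)%:E) `^ 2^-1)%E.
Proof.
rewrite /L2norm unlock; congr (_ `^ _)%E; apply: eq_integral => x _ /=.
by rewrite powR_mulrn// real_normK// num_real.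
Qed.

Lemma L2norm_sqrt f : L2 f -> L2norm pi f = (Num.sqrt (L2ip f f))%:E.
Proof.
move=> Lf; rewrite L2normE L2_integral_sqr// poweR_EFin powR12_sqrt//.
exact: sip_ge0 L2_sip _ Lf.
Qed.

Lemma L2norm_sqr f : L2 f -> (L2norm pi f ^+ 2)%E = (L2ip f f)%:E.
Proof.
move=> Lf; rewrite L2norm_sqrt// -EFin_expe sqr_sqrtr//.
exact: sip_ge0 L2_sip _ Lf.
Qed.

Lemma L2_intro f : measurable_fun setT f -> (L2norm pi f < +oo)%E -> L2 f.
Proof. by move=> mf fy; rewrite /L2/= inE; apply/andP; split; rewrite inE. Qed.

Lemma L2_ae f g : measurable_fun setT f -> L2 g ->
  (\forall x \ae pi, f x = g x) -> L2 f.
Proof.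
move=> mf Lg fg; have mg := L2_measurable Lg.
apply: L2_intro => //.
have <- : L2norm pi g = L2norm pi f; last by rewrite L2norm_sqrt// ltry.
rewrite !L2normE; congr (_ `^ _)%E; apply: ae_eq_integral => //.
- by apply/measurable_EFinP; exact: measurable_funX.
- by apply/measurable_EFinP; exact: measurable_funX.
- by apply: filterS fg => x -> _.
Qed.

Lemma L2ip_ae f g w : measurable_fun setT f -> L2 g -> L2 w ->
  (\forall x \ae pi, f x = g x) -> L2ip f w = L2ip g w.
Proof.
move=> mf Lg Lw fg; have mg := L2_measurable Lg; have mw := L2_measurable Lw.
congr fine; apply: ae_eq_integral => //.
- by apply/measurable_EFinP; exact: measurable_funM.
- by apply/measurable_EFinP; exact: measurable_funM.
- by apply: filterS fg => x -> _.
Qed.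

Lemma orthonormal_basis_onb (B : set (T -> R)) :
  orthonormal_basis pi B -> onb L2 L2ip B.
Proof.
case=> BL B1 Bo Bd; split => // u Lu eps eps0.
have seps0 : 0 < Num.sqrt eps by rewrite sqrtr_gt0.
have [n [e [c [Be ule]]]] := Bd _ Lu _ seps0.
exists n, e, c; split => //.
have <- : (fun x => u x - \sum_(i < n) c i * e i x) = u - \sum_(i < n) c i *: e i.
  by apply/funext => x; rewrite !fctE fct_sumE.
have Lus : L2 (fun x => u x - \sum_(i < n) c i * e i x).
  have -> : (fun x => u x - \sum_(i < n) c i * e i x) = u - \sum_(i < n) c i *: e i.
    by apply/funext => x; rewrite !fctE fct_sumE.
  by apply: (sip_closedB L2_sip Lu); apply: (sip_closed_sum L2_sip) => i _; exact: BL.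
move: ule; rewrite L2norm_sqrt// lte_fin ltr_sqrt//.
Qed.

Lemma hs_sqnormE B (A : (T -> R) -> T -> R) : onb L2 L2ip B ->
  (forall u, L2 u -> L2 (A u)) -> hs_sqnorm pi B A = hs L2ip B A.
Proof.
move=> oB LA; apply: eq_esum => e /(onb_sub oB) Le.
by rewrite L2norm_sqr//; exact: LA.
Qed.

End L2.

(** * Markov kernels as operators *)

Section kernel_operators.
Context {R : realType} {d} {T : measurableType d}.
Variable pi : probability T R.
Implicit Types (K : R.-pker T ~> T) (f g : T -> R).

Lemma measurable_kernel_op K f : measurable_fun setT f ->
  measurable_fun setT (kernel_op K f).
Proof.
move=> mf; apply: measurableT_comp => //.
under eq_fun do rewrite integralE.
apply: emeasurable_funB.
- apply: measurable_fun_integral_kernel => //; first exact: measurable_kernel.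
  by apply: measurable_funepos; exact/measurable_EFinP.
- apply: measurable_fun_integral_kernel => //; first exact: measurable_kernel.
  by apply: measurable_funeneg; exact/measurable_EFinP.
Qed.

Lemma bounded_on_L2_closed K f : bounded_on_L2 pi K -> L2 pi f ->
  L2 pi (kernel_op K f).
Proof.
move=> [_ [C KC]] Lf; apply: L2_intro.
  exact: measurable_kernel_op (L2_measurable Lf).
by rewrite (le_lt_trans (KC _ Lf))// L2norm_sqrt// -EFinM ltry.
Qed.

(** [kernel_op K] is linear only at the points where both functions are
    integrable for [K x]; almost all points are. *)
Lemma bounded_on_L2_operator K : bounded_on_L2 pi K ->
  bounded_operator (L2 pi) (L2ip pi) (kernel_op K).
Proof.
move=> bK; have [Ki [C KC]] := bK; have KL := bounded_on_L2_closed bK.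
have sip := L2_sip pi.
split=> [//|c u v w Lu Lv Lw|].
- rewrite -(sip_linear sip)//; [|exact: KL|exact: KL].
  apply: L2ip_ae => //.
  + exact: measurable_kernel_op (L2_measurable (sip_closed sip c Lu Lv)).
  + by apply: sip_closed sip _ _ _ _ _; exact: KL.
  + apply: filterS2 (Ki _ Lu) (Ki _ Lv) => x iu iv.
    rewrite /kernel_op -[RHS]/(c * (\int[K x]_y u y) + \int[K x]_y v y).
    rewrite -RintegralZl// -RintegralD//.
    exact: integrable_scale.
- exists (C ^+ 2) => f Lf; have := KC _ Lf; have LKf := KL _ Lf.
  rewrite !L2norm_sqrt// -EFinM lee_fin => le1.
  rewrite -[leLHS]sqr_sqrtr ?(sip_ge0 sip)//.
  rewrite -[X in _ * X]sqr_sqrtr ?(sip_ge0 sip)// -exprMn.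
  by rewrite ler_sqr ?nnegrE ?sqrtr_ge0// (le_trans _ le1)// sqrtr_ge0.
Qed.

Lemma operator_bounded_on_L2 K :
  (forall f, L2 pi f -> {ae pi, forall x, (K x).-integrable setT (EFin \o f)}) ->
  bounded_operator (L2 pi) (L2ip pi) (kernel_op K) -> bounded_on_L2 pi K.
Proof.
move=> Ki bK; split=> //; have sip := L2_sip pi.
have [C C0 KC] := bounded_operator_ge0 sip bK.
exists (Num.sqrt C) => f Lf; have LKf := bop_closed bK Lf.
rewrite !L2norm_sqrt// -EFinM lee_fin -sqrtrM// ler_sqrt ?KC//.
by rewrite mulr_ge0// (sip_ge0 sip).
Qed.

Lemma eq_kernel_op K K' : (forall x A, measurable A -> K x A = K' x A) ->
  kernel_op K = kernel_op K'.
Proof.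
move=> KK'; apply/funext => f; apply/funext => x; congr fine.
by apply: eq_measure_integral => A mA _; exact: KK'.
Qed.

End kernel_operators.

(** * Measurable actions and double augmentation *)

Section action.
Context {R : realType} {gT : finGroupType} {d} {T : measurableType d}.
Variables (a : measurable_action gT T).

Lemma act_gK g : cancel (a g) (a g^-1%g).
Proof. by move=> x; rewrite -Defs.actM mulVg Defs.act1. Qed.

Lemma act_gVK g : cancel (a g^-1%g) (a g).
Proof. by move=> x; rewrite -Defs.actM mulgV Defs.act1. Qed.

(** Invariance is stated for images, integration theory needs preimages. *)
Lemma act_imageE g A : a g @` A = a g^-1%g @^-1` A.
Proof.
apply/seteqP; split=> [_ [x Ax <-]|x /= Ax]; first by rewrite /= act_gK.
by exists (a g^-1%g x); rewrite ?act_gVK.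
Qed.

Lemma measurable_act_preimage g A : measurable A -> measurable (a g @^-1` A).
Proof. by move=> mA; rewrite -[X in measurable X]setTI; exact: measurable_act. Qed.

(** The measure structure of a pushforward depends on a proof that the map is
    measurable, which is supplied here once and for all. *)
Definition act_pushforward (m : {measure set T -> \bar R}) g :
    {measure set T -> \bar R} :=
  @measure_function_pushforward__canonical__measure_function_Measure
    _ _ _ _ _ m (a g) (measurable_act a g).

Lemma ge0_integral_act (m : {measure set T -> \bar R}) g (f : T -> \bar R) :
  measurable_fun setT f -> (forall x, 0 <= f x)%E ->
  (\int[act_pushforward m g]_x f x = \int[m]_x f (a g x))%E.
Proof.
by move=> mf f0; apply: (ge0_integral_pushforward (measurable_act a g)).
Qed.

Section invariant.
Variable pi : probability T R.
Hypothesis hpi : invariant_measure a pi.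

Lemma invariant_preimage g A : measurable A -> pi (a g @^-1` A) = pi A.
Proof. by move=> mA; rewrite -(hpi g^-1%g mA) act_imageE invgK. Qed.

Lemma ge0_integral_invariant g (f : T -> \bar R) : measurable_fun setT f ->
  (forall x, 0 <= f x)%E -> (\int[pi]_x f (a g x) = \int[pi]_x f x)%E.
Proof.
move=> mf f0; rewrite -ge0_integral_act//; apply: eq_measure_integral => A mA _.
exact: invariant_preimage.
Qed.

Lemma ae_invariant g (Q : T -> Prop) :
  {ae pi, forall x, Q x} -> {ae pi, forall x, Q (a g x)}.
Proof.
move=> [A [mA A0 QA]]; exists (a g @^-1` A); split.
- exact: measurable_act_preimage.
- by rewrite [LHS]invariant_preimage.
- by move=> x /= Qx; exact: QA.
Qed.

Lemma L2_act g f : L2 pi f -> L2 pi (f \o a g).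
Proof.
move=> Lf; have mf := L2_measurable Lf.
apply: L2_intro.
  by apply: measurableT_comp => //; exact: measurable_act.
rewrite L2normE (@ge0_integral_invariant g (fun x => (f x ^+ 2)%:E)).
- by rewrite -L2normE L2norm_sqrt// ltry.
- by apply/measurable_EFinP; exact: measurable_funX.
- by move=> x; rewrite lee_fin sqr_ge0.
Qed.

Lemma Rintegral_invariant g f : measurable_fun setT f ->
  \int[pi]_x f (a g x) = \int[pi]_x f x.
Proof.
move=> mf; rewrite /Rintegral [in LHS]integralE [in RHS]integralE.
have mf' : measurable_fun setT (EFin \o f) by exact/measurable_EFinP.
rewrite -(ge0_integral_invariant g (measurable_funepos mf'))//.
rewrite -(ge0_integral_invariant g (measurable_funeneg mf'))//.
by congr (fine (_ - _)%E); apply: eq_integral => x _;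
  rewrite ?funeposE ?funenegE.
Qed.

Lemma unitary_act g :
  unitary (L2 pi) (L2ip pi) (fun f => f \o a g) (fun f => f \o a g^-1%g).
Proof.
split=> //.
- by move=> u; exact: L2_act.
- by move=> u; exact: L2_act.
- move=> u v Lu Lv; apply: (@Rintegral_invariant g (fun x => u x * v x)).
  exact: measurable_funM (L2_measurable Lu) (L2_measurable Lv).
- by move=> u; apply/funext => x /=; rewrite act_gVK.
- by move=> u; apply/funext => x /=; rewrite act_gK.
Qed.

End invariant.
End action.

Lemma ge0_integral_fdiscreteX {R : realType} {gT : finGroupType}
    (nu : probability (fdiscrete gT * fdiscrete gT)%type R)
    (F : fdiscrete gT * fdiscrete gT -> \bar R) : (forall p, 0 <= F p)%E ->
  (\int[nu]_p F p = \sum_p nu [set p] * F p)%E.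
Proof.
move=> F0; pose ind (q p : fdiscrete gT * fdiscrete gT) : R := \1_[set q] p.
have indE q p : ind q p = (p == q)%:R.
  by rewrite /ind indicE; congr (nat_of_bool _)%:R; apply/idP/eqP; rewrite inE.
have ind0 q p : 0 <= ind q p by rewrite /ind indicE.
have mF (G : fdiscrete gT * fdiscrete gT -> \bar R) : measurable_fun setT G.
  by move=> _ B _; exact: measurable_fdiscreteX.
transitivity (\int[nu]_p \sum_q F q * (ind q p)%:E)%E.
  apply: eq_integral => p _; rewrite (bigD1 p)//= big1 ?adde0.
    by rewrite indE eqxx mule1.
  by move=> q qp; rewrite indE eq_sym (negbTE qp) mule0.
rewrite ge0_integral_sum//; last first.
  by move=> q p _; rewrite mule_ge0// lee_fin.
apply: eq_bigr => q _; rewrite ge0_integralZl// => [|p _]; last by rewrite lee_fin.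
rewrite integral_indic// ?setIT 1?muleC//.
exact: measurable_fdiscreteX.
Qed.

Section double_augmentation.
Context {R : realType} {gT : finGroupType} {d} {T : measurableType d}.
Variables (a : measurable_action gT T).
Variable nu : probability (fdiscrete gT * fdiscrete gT)%type R.
Implicit Types (K : R.-pker T ~> T) (p : fdiscrete gT * fdiscrete gT).

Definition weight p : R := fine (nu [set p]).

Lemma weightE p : (weight p)%:E = nu [set p].
Proof. by rewrite fineK// fin_num_measure//; exact: measurable_fdiscreteX. Qed.

Lemma weight_ge0 p : 0 <= weight p.
Proof. by rewrite fine_ge0. Qed.

Lemma weight_sum1 : \sum_p weight p = 1.
Proof.
apply: EFin_inj; rewrite -sumEFin.
transitivity (\int[nu]_p (cst 1%E p))%E; last first.
  by rewrite integral_cst// mul1e; exact: probability_setT.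
rewrite ge0_integral_fdiscreteX//.
by apply: eq_bigr => p _; rewrite mule1 weightE.
Qed.

Lemma weight_pair_inv : inv_symmetric nu -> forall p, weight (pair_inv p) = weight p.
Proof.
move=> hnu p; rewrite /weight -(hnu [set p]); last exact: measurable_fdiscreteX.
rewrite /pushforward; congr (fine (nu _)); apply/seteqP.
rewrite /pair_inv; split=> [q /= ->|q /= <-] /=; first by rewrite !invgK; case: (p).
by rewrite !invgK; case: (q).
Qed.

Lemma daE K x A : da a nu K x A =
  (\sum_p (weight p)%:E * K (a p.1 x) (a p.2 @^-1` A))%E.
Proof.
rewrite [LHS]ge0_integral_fdiscreteX => [|p]; last by rewrite /pushforward measure_ge0.
by apply: eq_bigr => p _; rewrite weightE.
Qed.

Lemma ge0_integral_da K x (f : T -> \bar R) : measurable_fun setT f ->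
  (forall y, 0 <= f y)%E ->
  (\int[da a nu K x]_y f y =
   \sum_p (weight p)%:E * \int[K (a p.1 x)]_y f (a p.2 y))%E.
Proof.
move=> mf f0.
(* Finite sums of measures are indexed by initial segments of [nat]. *)
pose q n : fdiscrete gT * fdiscrete gT := nth (1%g, 1%g) (index_enum _) n.
pose m_ n : {measure set T -> \bar R} :=
  mscale (NngNum (weight_ge0 (q n))) (act_pushforward a (K (a (q n).1 x)) (q n).2).
pose N := size (index_enum (fdiscrete gT * fdiscrete gT)%type).
have sumq (F : fdiscrete gT * fdiscrete gT -> \bar R) :
    (\sum_p F p = \sum_(n < N) F (q n))%E.
  by rewrite (big_nth (1%g, 1%g)) big_mkord.
rewrite (@eq_measure_integral _ _ _ setT (msum m_ N)); last first.
  by move=> A mA _; rewrite daE sumq.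
rewrite ge0_integral_measure_sum// sumq; apply: eq_bigr => n _.
by rewrite ge0_integral_mscale// ge0_integral_act.
Qed.

Lemma da_integrable K x f : measurable_fun setT f ->
  (forall p, (K (a p.1 x)).-integrable setT (EFin \o (f \o a p.2))) ->
  (da a nu K x).-integrable setT (EFin \o f).
Proof.
move=> mf Kf; apply/integrableP; split; first exact/measurable_EFinP.
rewrite ge0_integral_da//; last first.
  by apply: measurableT_comp => //; exact/measurable_EFinP.
apply: lte_sum_pinfty => p _; apply: lte_mul_pinfty => //.
  by rewrite lee_fin weight_ge0.
by have /integrableP[] := Kf p.
Qed.

Lemma da_kernel_op K x f : measurable_fun setT f ->
  (forall p, (K (a p.1 x)).-integrable setT (EFin \o (f \o a p.2))) ->
  kernel_op (da a nu K) f x =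
    \sum_p weight p * kernel_op K (f \o a p.2) (a p.1 x).
Proof.
move=> mf Kf; have mf' : measurable_fun setT (EFin \o f) by exact/measurable_EFinP.
pose Kp p := (\int[K (a p.1 x)]_y (EFin \o f)^\+ (a p.2 y))%E.
pose Kn p := (\int[K (a p.1 x)]_y (EFin \o f)^\- (a p.2 y))%E.
have Kp_fin p : Kp p \is a fin_num.
  rewrite /Kp (_ : (\int[_]__ _)%E =
    (\int[K (a p.1 x)]_y (EFin \o (f \o a p.2))^\+ y)%E).
    exact/integrable_pos_fin_num.
  by apply: eq_integral => y _; rewrite !funeposE.
have Kn_fin p : Kn p \is a fin_num.
  rewrite /Kn (_ : (\int[_]__ _)%E =
    (\int[K (a p.1 x)]_y (EFin \o (f \o a p.2))^\- y)%E).
    exact/integrable_neg_fin_num.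
  by apply: eq_integral => y _; rewrite !funenegE.
rewrite /kernel_op /Rintegral integralE.
rewrite ge0_integral_da//; last exact: measurable_funepos.
rewrite ge0_integral_da//; last exact: measurable_funeneg.
have sumE F : (forall p, F p \is a fin_num) ->
    (\sum_p (weight p)%:E * F p)%E = (\sum_p weight p * fine (F p))%:E.
  by move=> Ff; rewrite -sumEFin; apply: eq_bigr => p _; rewrite EFinM (fineK (Ff p)).
rewrite -/Kp -/Kn !sumE//= -sumrB; apply: eq_bigr => p _.
rewrite -mulrBr -(fineB (Kp_fin p) (Kn_fin p)) [in RHS]integralE.
congr (_ * fine (_ - _)%E).
- by apply: eq_integral => y _; rewrite !funeposE.
- by apply: eq_integral => y _; rewrite !funenegE.
Qed.

Section invariant.
Variable pi : probability T R.
Hypothesis hpi : invariant_measure a pi.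
Variable K : R.-pker T ~> T.
Hypothesis bK : bounded_on_L2 pi K.

(** Invariance transports the null set attached to [f \o a p.2] by [a p.1], and
    there are finitely many pairs [p]. *)
Lemma ae_integrable_act f : L2 pi f -> {ae pi, forall x p,
  (K (a p.1 x)).-integrable setT (EFin \o (f \o a p.2))}.
Proof.
move=> Lf; apply: filter_forall => p.
have [Ki _] := bK.
exact: (ae_invariant hpi p.1 (Ki _ (L2_act hpi p.2 Lf))).
Qed.

Lemma ae_integrable_da f : L2 pi f ->
  {ae pi, forall x, (da a nu K x).-integrable setT (EFin \o f)}.
Proof.
move=> Lf; apply: filterS (ae_integrable_act Lf) => x Kf.
exact: da_integrable (L2_measurable Lf) Kf.
Qed.

Lemma ae_da_kernel_op f : L2 pi f -> {ae pi, forall x,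
  kernel_op (da a nu K) f x =
  (\sum_p weight p *: (kernel_op K (f \o a p.2) \o a p.1)) x}.
Proof.
move=> Lf; apply: filterS (ae_integrable_act Lf) => x Kf.
by rewrite (da_kernel_op (L2_measurable Lf) Kf) fct_sumE.
Qed.

Let Lconj f p : L2 pi f -> L2 pi (kernel_op K (f \o a p.2) \o a p.1).
Proof.
by move=> Lf; apply: L2_act => //; apply: bounded_on_L2_closed => //; exact: L2_act.
Qed.

Lemma L2_da f : L2 pi f -> L2 pi (kernel_op (da a nu K) f).
Proof.
move=> Lf; apply: L2_ae (ae_da_kernel_op Lf).
  exact: measurable_kernel_op (L2_measurable Lf).
by apply: (sip_closed_sum (L2_sip pi)) => p _; exact: Lconj.
Qed.

Lemma da_twirl : twirl_of (L2 pi) (L2ip pi) weight (fun p f => f \o a p.1)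
  (fun p f => f \o a p.2) (kernel_op K) (kernel_op (da a nu K)).
Proof.
move=> u w Lu Lw; rewrite (L2ip_ae _ _ Lw (ae_da_kernel_op Lu)).
- by rewrite (sip_suml (L2_sip pi))// => p _; exact: Lconj.
- exact: measurable_kernel_op (L2_measurable Lu).
- by apply: (sip_closed_sum (L2_sip pi)) => p _; exact: Lconj.
Qed.

End invariant.
End double_augmentation.

Section kernel_pythagoras.
Context {R : realType} {gT : finGroupType} {d} {T : measurableType d}.
Variables (a : measurable_action gT T) (pi : probability T R).
Hypothesis hpi : invariant_measure a pi.
Variable nu : probability (fdiscrete gT * fdiscrete gT)%type R.
Implicit Types (P M K : R.-pker T ~> T) (p : fdiscrete gT * fdiscrete gT).

(** Finiteness in one orthonormal basis is finiteness in all of them. *)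
Lemma hilbert_schmidt_operator K B : hilbert_schmidt pi K ->
  orthonormal_basis pi B -> hs_operator (L2 pi) (L2ip pi) B (kernel_op K).
Proof.
move=> [bK [B0 /orthonormal_basis_onb oB0 fK]] /orthonormal_basis_onb oB.
have opK := bounded_on_L2_operator bK.
split=> //; rewrite (hs_indep (L2_sip pi) oB oB0 opK).
by rewrite -hs_sqnormE//; exact: bop_closed opK.
Qed.

Let U p (f : T -> R) : T -> R := f \o a p.1.
Let W p (f : T -> R) : T -> R := f \o a p.2.
Let uU p : unitary (L2 pi) (L2ip pi) (U p) (U (@pair_inv gT p)).
Proof. exact: unitary_act. Qed.
Let uW p : unitary (L2 pi) (L2ip pi) (W p) (W (@pair_inv gT p)).
Proof. exact: unitary_act. Qed.

Lemma hilbert_schmidt_da K : hilbert_schmidt pi K -> hilbert_schmidt pi (da a nu K).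
Proof.
move=> hK; have [bK [B oB _]] := hK.
have tK := da_twirl nu hpi bK; have LK := L2_da nu hpi bK.
have opK := bounded_on_L2_operator bK.
have bQ : bounded_on_L2 pi (da a nu K).
  apply: operator_bounded_on_L2 (ae_integrable_da nu hpi bK) _.
  exact: (twirl_bounded (L2_sip pi) (weight_ge0 nu) (weight_sum1 nu) uU uW opK tK LK).
split=> //; exists B => //.
have oB' := orthonormal_basis_onb oB.
have hopK := hilbert_schmidt_operator hK oB.
rewrite hs_sqnormE//.
exact: hs_finite (twirl_hs (L2_sip pi) (weight_ge0 nu) (weight_sum1 nu) uU uW oB'
  hopK tK LK).
Qed.

Lemma da_class_twirl K : bounded_on_L2 pi K -> da_class a nu K ->
  twirl_of (L2 pi) (L2ip pi) (weight nu) U W (kernel_op K) (kernel_op K).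
Proof.
move=> bK cK; have := da_twirl nu hpi bK.
by rewrite (eq_kernel_op (K := da a nu K) (K' := K)).
Qed.

Lemma pair_invK : involutive (@pair_inv gT).
Proof. by move=> [g h]; rewrite /pair_inv /= !invgK. Qed.

Lemma hs_sqnorm_pythagoras P M B : inv_symmetric nu ->
  hilbert_schmidt pi P -> hilbert_schmidt pi M ->
  da_class a nu M -> da_class a nu (da a nu P) -> orthonormal_basis pi B ->
  (hs_sqnorm pi B (fun f => (kernel_op P f - kernel_op M f)%R) =
   hs_sqnorm pi B (fun f => (kernel_op P f - kernel_op (da a nu P) f)%R) +
   hs_sqnorm pi B (fun f => (kernel_op (da a nu P) f - kernel_op M f)%R))%E.
Proof.
move=> hnu hP hM cM cQ oB; have hQ := hilbert_schmidt_da hP.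
have sip := L2_sip pi; have oB' := orthonormal_basis_onb oB.
have [[bP _] [bM _] [bQ _]] := And3 hP hM hQ.
have LB K K' : bounded_on_L2 pi K -> bounded_on_L2 pi K' ->
    forall u, L2 pi u -> L2 pi (kernel_op K u - kernel_op K' u).
  by move=> bK bK' u Lu; apply: (sip_closedB sip); exact: bounded_on_L2_closed.
rewrite !hs_sqnormE//; do ?exact: LB.
exact: (hs_twirl_pythagoras sip (weight_pair_inv hnu) pair_invK uU uW oB'
  (hilbert_schmidt_operator hP oB) (hilbert_schmidt_operator hM oB)
  (hilbert_schmidt_operator hQ oB) (da_twirl nu hpi bP)
  (da_class_twirl bQ cQ) (da_class_twirl bM cM)).
Qed.

End kernel_pythagoras.

(** * Transition matrices on a finite space *)

Section frobenius.
Context {R : realType} {gT : finGroupType} {d} {T : measurableType d}.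
Hypothesis fT : finite_set [set: T].
Implicit Types A B C : T -> T -> R.

Definition frobenius_ip A B : R :=
  \sum_(x \in [set: T]) \sum_(y \in [set: T]) A x y * B x y.

Let s : seq T := (fset_set [set: T]).

Lemma frobenius_ipE A B :
  frobenius_ip A B = \sum_(x <- s) \sum_(y <- s) A x y * B x y.
Proof.
by rewrite /frobenius_ip fsbig_finite//; apply: eq_bigr => x _; rewrite fsbig_finite.
Qed.

Lemma frobenius_ipC A B : frobenius_ip A B = frobenius_ip B A.
Proof.
by rewrite !frobenius_ipE; do 2!apply: eq_bigr => ? _; rewrite mulrC.
Qed.

Lemma frobenius_ipB A B C :
  frobenius_ip (fun x y => A x y - B x y) C = frobenius_ip A C - frobenius_ip B C.
Proof.
rewrite !frobenius_ipE -sumrB; apply: eq_bigr => x _; rewrite -sumrB.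
by apply: eq_bigr => y _; rewrite mulrBl.
Qed.

Lemma frobenius_ip_sum (I : finType) (p : I -> R) (F : I -> T -> T -> R) C :
  frobenius_ip (fun x y => \sum_i p i * F i x y) C =
  \sum_i p i * frobenius_ip (F i) C.
Proof.
rewrite frobenius_ipE; under [RHS]eq_bigr => i _ do rewrite frobenius_ipE mulr_sumr.
rewrite [RHS]exchange_big; apply: eq_bigr => x _.
under [RHS]eq_bigr => i _ do rewrite mulr_sumr.
rewrite [RHS]exchange_big; apply: eq_bigr => y _; rewrite mulr_suml.
by apply: eq_bigr => i _; rewrite mulrA.
Qed.

Lemma frobenius_sqnormE A : frobenius_sqnorm A = frobenius_ip A A.
Proof.
by apply: eq_fsbigr => x _; apply: eq_fsbigr => y _; rewrite expr2.
Qed.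

Variables (a : measurable_action gT T).
Variable nu : probability (fdiscrete gT * fdiscrete gT)%type R.
Hypothesis hnu : inv_symmetric nu.
Hypothesis mT : forall y : T, measurable [set y].
Implicit Types (P M K : R.-pker T ~> T) (p : fdiscrete gT * fdiscrete gT).

Definition act_mx (p : fdiscrete gT * fdiscrete gT) A : T -> T -> R :=
  fun x y => A (a p.1 x) (a p.2^-1%g y).

Lemma frobenius_ip_act p A B :
  frobenius_ip (act_mx p A) B = frobenius_ip A (act_mx (pair_inv p) B).
Proof.
rewrite /frobenius_ip (reindex_fsbigT (a p.1^-1%g)); last first.
  by exists (a p.1); [exact: act_gVK|exact: act_gK].
apply: eq_fsbigr => x _; rewrite (reindex_fsbigT (a p.2)); last first.
  by exists (a p.2^-1%g); [exact: act_gK|exact: act_gVK].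
by apply: eq_fsbigr => y _; rewrite /act_mx /= act_gVK act_gK invgK.
Qed.

Lemma kernel_mx_da K x y :
  kernel_mx (da a nu K) x y = \sum_p weight nu p * act_mx p (kernel_mx K) x y.
Proof.
rewrite /kernel_mx daE -[RHS]/(fine _%:E) -sumEFin; congr fine.
apply: eq_bigr => p _; rewrite EFinM; congr (_ * _)%E.
have -> : a p.2 @^-1` [set y] = [set a p.2^-1%g y].
  by apply/seteqP; split=> z /= => [<-|->]; rewrite ?act_gK ?act_gVK.
rewrite /act_mx fineK// ge0_fin_numE// (le_lt_trans _ (ltry 1))//.
by rewrite -(@prob_kernel _ _ _ _ _ K (a p.1 x)); apply: le_measure; rewrite ?inE.
Qed.

(** [frobenius_ip_act] makes the averaging of matrices self-adjoint, so that the
    increments [P - Q] and [Q - M] are orthogonal. *)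
Lemma frobenius_pythagoras P M : da_class a nu M -> da_class a nu (da a nu P) ->
  frobenius_sqnorm (fun x y => kernel_mx P x y - kernel_mx M x y) =
  frobenius_sqnorm (fun x y => kernel_mx P x y - kernel_mx (da a nu P) x y) +
  frobenius_sqnorm (fun x y => kernel_mx (da a nu P) x y - kernel_mx M x y).
Proof.
move=> cM cQ; set Q := da a nu P in cQ *.
set p := kernel_mx P; set q := kernel_mx Q; set m := kernel_mx M.
pose D x y := q x y - m x y.
have cE K x y : da_class a nu K -> kernel_mx K x y =
    \sum_i weight nu i * act_mx i (kernel_mx K) x y.
  by move=> cK; rewrite -kernel_mx_da /kernel_mx cK.
have DE : (fun x y => \sum_i weight nu i * act_mx i D x y) = D.
  apply/funext => x; apply/funext => y; rewrite /D /q /m (cE Q)// (cE M)// -sumrB.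
  by apply: eq_bigr => i _; rewrite -mulrBr.
(* The average is self-adjoint and fixes [D]. *)
have qD : frobenius_ip q D = frobenius_ip p D.
  have -> : q = (fun x y => \sum_i weight nu i * act_mx i p x y).
    by apply/funext => x; apply/funext => y; rewrite -kernel_mx_da.
  rewrite frobenius_ip_sum frobenius_ipC -{2}DE frobenius_ip_sum.
  rewrite (reindex_inj (inv_inj (@pair_invK gT))); apply: eq_bigr => i _.
  by rewrite weight_pair_inv// frobenius_ip_act pair_invK frobenius_ipC.
pose N x y := p x y - m x y.
have ND : frobenius_ip N N = frobenius_ip (fun x y => p x y - q x y)
    (fun x y => p x y - q x y) + frobenius_ip D D; last by rewrite !frobenius_sqnormE.
have expand A B : frobenius_ip A A = frobenius_ip (fun x y => A x y - B x y)
  (fun x y => A x y - B x y) + 2 * frobenius_ip (fun x y => A x y - B x y) B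
  + frobenius_ip B B.
  set AB := (fun x y => A x y - B x y).
  have e C : frobenius_ip AB C = frobenius_ip A C - frobenius_ip B C.
    exact: frobenius_ipB.
  by rewrite !e (frobenius_ipC A AB) (frobenius_ipC B AB) !e (frobenius_ipC B A); ring.
rewrite (expand N D).
have -> : (fun x y => N x y - D x y) = (fun x y => p x y - q x y).
  by apply/funext => x; apply/funext => y; rewrite /N /D; ring.
by rewrite (frobenius_ipB p q D) qD subrr mulr0 addr0.
Qed.

End frobenius.

(** A point is closed because the metric separates it from every other point. *)
Lemma polish_set1_measurable {R : realType} (X : ptopologicalType) (y : borel X) :
  polish R X -> measurable [set y].
Proof.
move=> [_ [dist [d0 dC dT dnbhs _]]].
rewrite -[X in measurable X]setCK; apply: measurableC; apply: sub_sigma_algebra.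
rewrite /= openE => x /= xy.
have dge0 u v : 0 <= dist u v.
  have := dT u v u; rewrite (dC v u) ((d0 u u).2 erefl); lra.
apply/dnbhs; exists (dist x y).
  rewrite lt_def dge0 andbT; apply/eqP => /d0; exact: xy.
by move=> z /= zy ez; move: zy; rewrite ez ltxx.
Qed.

Unset Implicit Arguments.

Theorem theorem4p3 (R : realType) (X : ptopologicalType) (hX : polish R X)
  (gT : finGroupType)
  (mu : probability (fdiscrete gT) R) (hmu : haar mu)
  (a : measurable_action gT (borel X))
  (m : {measure set (borel X) -> \bar R}) (hm : invariant_measure a m)
  (pi : probability (borel X) R) (hpim : has_density pi m)
  (hpi : invariant_measure a pi)
  (nu : probability (fdiscrete gT * fdiscrete gT)%type R)
  (hnu : inv_symmetric nu)
  (P M : R.-pker (borel X) ~> (borel X))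
  (hP : hilbert_schmidt pi P) (hM : hilbert_schmidt pi M)
  (hMD : da_class a nu M) (hPD : da_class a nu (da a nu P)) :
  [/\ hilbert_schmidt pi (da a nu P),
      forall B : set (borel X -> R), orthonormal_basis pi B ->
        (hs_sqnorm pi B (fun f => (kernel_op P f - kernel_op M f)%R) =
         hs_sqnorm pi B (fun f => (kernel_op P f - kernel_op (da a nu P) f)%R) +
         hs_sqnorm pi B (fun f => (kernel_op (da a nu P) f - kernel_op M f)%R))%E
    & finite_set [set: X] ->
        frobenius_sqnorm (fun x y => kernel_mx P x y - kernel_mx M x y) =
        frobenius_sqnorm
          (fun x y => kernel_mx P x y - kernel_mx (da a nu P) x y) +
        frobenius_sqnorm
          (fun x y => kernel_mx (da a nu P) x y - kernel_mx M x y)].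
Proof.
split.
- exact: hilbert_schmidt_da.
- by move=> B oB; exact: hs_sqnorm_pythagoras.
- move=> fX; apply: frobenius_pythagoras => // y.
  exact: polish_set1_measurable hX.
Qed.
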